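(* Let $G_1$ be any tree and $G_2$ any graph. Then \[ \delta(G_1\circ G_2)=\begin{cases} \delta(G_2), & \text{if } G_1\simeq E_1,\\ 0, & \text{if } G_2\simeq E_1,\\ 1, & \text{if } \operatorname{diam} G_1=1 \text{ and } 1\le \operatorname{diam} G_2\le 2,\\ 5/4, & \text{if } \operatorname{diam} G_1=1,\ \operatorname{diam} G_2>2 \text{ and } G_2\notin\mathcal{F},\\ 5/4, & \text{if } \operatorname{diam} G_1=2,\ \operatorname{diam} G_2\ge 1 \text{ and } G_2\notin\mathcal{F},\\ 3/2, & \text{if } 1\le \operatorname{diam} G_1\le 2 \text{ and } G_2\in\mathcal{F},\\ 3/2, & \text{if } \operatorname{diam} G_1\ge 3 \text{ and } \operatorname{diam} G_2\ge 1. \end{cases} \]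
   Context: All graphs are simple and connected (possibly infinite) and every edge has length $1$. A graph $G$ is viewed as a geodesic metric space by identifying each edge isometrically with $[0,1]$; points of $G$ are its vertices and the interior points of its edges, $d_G$ is the length of a shortest path, and $\operatorname{diam} G=\sup\{d_G(x,y): x,y\in G\}$ (over all points, not only vertices). $E_1$ is the trivial graph (a single vertex, regarded as a tree), and $\simeq$ denotes graph isomorphism. Lexicographic product $G_1\circ G_2$: vertex set $V(G_1)\times V(G_2)$; two distinct vertices $(u_1,v_1)$ and $(u_2,v_2)$ are adjacent if either $[u_1,u_2]\in E(G_1)$, or $u_1=u_2$ and $[v_1,v_2]\in E(G_2)$. A geodesic triangle $T=\{x_1,x_2,x_3\}$ in a geodesic metric space $X$ is the union of three geodesics $[x_1x_2],[x_2x_3],[x_3x_1]$. It is $\delta$-thin if every point of each side is at distance at most $\delta$ from the union of the other two sides; $\delta(T)=\inf\{\delta\ge 0: T \text{ is } \delta\text{-thin}\}$ and $\delta(X)=\sup\{\delta(T): T \text{ a geodesic triangle in } X\}\in[0,\infty]$. The family $\mathcal{F}$. Let $C_n$ be the cycle graph with vertices $v_1,\dots,v_n$ and edges $[v_i,v_{i+1}]$ ($1\le i\le n-1$) and $[v_n,v_1]$. Define the following sets of graphs, where ''subset'' may be empty, proper, or the whole set: - $\mathcal{C}_6^{(1)}$: graphs obtained from $C_6$ by adding a subset of the edges $\{[v_2,v_6],[v_4,v_6]\}$; - $\mathcal{C}_7^{(1)}$: graphs obtained from $C_7$ by adding a subset of $\{[v_2,v_6],[v_2,v_7],[v_4,v_6],[v_4,v_7]\}$;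 - $\mathcal{C}_8^{(1)}$: graphs obtained from $C_8$ by adding a subset of $\{[v_2,v_6],[v_2,v_8],[v_4,v_6],[v_4,v_8]\}$; - $\mathcal{C}_8^{(2)}$: graphs obtained from $C_8$ by adding a subset of $\{[v_2,v_8],[v_4,v_6],[v_4,v_7],[v_4,v_8]\}$; - $\mathcal{C}_9^{(1)}$: graphs obtained from $C_9$ by adding a subset of $\{[v_2,v_6],[v_2,v_9],[v_4,v_6],[v_4,v_9]\}$. $\mathcal{F}$ is the set of all graphs containing, as an induced subgraph, a graph isomorphic to some element of $\mathcal{C}_6^{(1)}\cup\mathcal{C}_7^{(1)}\cup\mathcal{C}_8^{(1)}\cup\mathcal{C}_8^{(2)}\cup\mathcal{C}_9^{(1)}$. *)

(* Defs.v *)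
From HB Require Import structures.
From Stdlib Require Import Relation_Operators.
From mathcomp Require Import all_boot all_order all_algebra.
From mathcomp Require Import mathcomp_extra boolp classical_sets functions.
From mathcomp Require Import reals ereal topology ring.

Set Implicit Arguments.
Unset Strict Implicit.
Unset Printing Implicit Defensive.

Import Order.TTheory GRing.Theory Num.Theory.

Local Open Scope classical_set_scope.
Local Open Scope ring_scope.

Record simple_graph := SimpleGraph {
  vertex :> Type;
  adj : vertex -> vertex -> Prop;
  adj_sym : forall x y, adj x y -> adj y x;
  adj_irrefl : forall x, ~ adj x x }.

Record graph := Graph {
  graph_base :> simple_graph;
  graph_nonempty : exists x : graph_base, True;
  graph_connected :
    forall x y : graph_base, clos_refl_trans graph_base (@adj graph_base) x y }.

Definition isomorphic (G H : simple_graph) : Prop :=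
  exists f : G -> H, bijective f /\ forall x y, adj x y <-> adj (f x) (f y).

Definition induced (G : simple_graph) (W : set G) : simple_graph :=
  @SimpleGraph {x : G | W x} (fun x y => adj (sval x) (sval y))
    (fun x y => @adj_sym G (sval x) (sval y)) (fun x => @adj_irrefl G (sval x)).

Definition E1 : simple_graph :=
  @SimpleGraph unit (fun _ _ => False) (fun _ _ h => h) (fun _ h => h).

(** The cycle [v_1, ..., v_n] with the extra edges [v_a, v_b], for (a, b) in
    [S]; the vertex [v_a] is the element of ['I_n] of value [a - 1]. *)
Definition chorded_cycle_adj (n : nat) (S : seq (nat * nat)) (i j : 'I_n) : bool :=
  (i != j) && [|| j == ordS i, i == ordS j,
                  (i.+1, j.+1) \in S | (j.+1, i.+1) \in S].

Lemma chorded_cycle_adj_sym n S (i j : 'I_n) :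
  chorded_cycle_adj S i j -> chorded_cycle_adj S j i.
Proof.
by rewrite /chorded_cycle_adj eq_sym => /andP[->] /or4P[] ->; rewrite ?orbT.
Qed.

Lemma chorded_cycle_adj_irrefl n S (i : 'I_n) : ~ chorded_cycle_adj S i i.
Proof. by rewrite /chorded_cycle_adj eqxx. Qed.

Definition chorded_cycle (n : nat) (S : seq (nat * nat)) : simple_graph :=
  SimpleGraph (@chorded_cycle_adj_sym n S) (@chorded_cycle_adj_irrefl n S).

Definition cycle_graph (n : nat) : simple_graph := chorded_cycle n [::].

(** A [graph] is connected by definition, so only the absence of cycles has
    to be required; cycles are subgraphs, not necessarily induced. *)
Definition tree (G : graph) : Prop :=
  forall n (c : cycle_graph n -> G), (2 < n)%N -> injective c ->
    ~ (forall i j, adj i j -> adj (c i) (c j)).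

Section LexProduct.
Variables G1 G2 : graph.

(** Adjacent pairs are automatically distinct. *)
Definition lex_adj (x y : G1 * G2) : Prop :=
  adj x.1 y.1 \/ x.1 = y.1 /\ adj x.2 y.2.

Lemma lex_adj_sym x y : lex_adj x y -> lex_adj y x.
Proof. by rewrite /lex_adj; case=> [/adj_sym|[-> /adj_sym]]; [left | right]. Qed.

Lemma lex_adj_irrefl x : ~ lex_adj x x.
Proof. by case=> [/adj_irrefl|[_ /adj_irrefl]]. Qed.

Definition lex_simple : simple_graph := SimpleGraph lex_adj_sym lex_adj_irrefl.

Lemma lex_nonempty : exists x : lex_simple, True.
Proof.
have [x _] := graph_nonempty G1.
by have [y _] := graph_nonempty G2; exists (x, y).
Qed.

Lemma lex_connected (x y : lex_simple) :
  clos_refl_trans lex_simple (@adj lex_simple) x y.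
Proof.
case: x y => [u v] [u' v']; apply: (@rt_trans _ _ _ ((u, v') : lex_simple)).
  elim: (graph_connected v v') => {v v'} [v w vw|v|v w t _ vw _ wt].
  - by apply: rt_step; right.
  - exact: rt_refl.
  - exact: rt_trans vw wt.
elim: (graph_connected u u') => {u u'} [u w uw|u|u w t _ uw _ wt].
- by apply: rt_step; left.
- exact: rt_refl.
- exact: rt_trans uw wt.
Qed.

Definition lexprod : graph := Graph lex_nonempty lex_connected.

End LexProduct.

(** Length of the cycle and labels of the optional chords in the classes
    C_6^(1), C_7^(1), C_8^(1), C_8^(2) and C_9^(1). *)
Definition F_patterns : seq (nat * seq (nat * nat)) :=
  [:: (6, [:: (2, 6); (4, 6)]);
      (7, [:: (2, 6); (2, 7); (4, 6); (4, 7)]);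
      (8, [:: (2, 6); (2, 8); (4, 6); (4, 8)]);
      (8, [:: (2, 8); (4, 6); (4, 7); (4, 8)]);
      (9, [:: (2, 6); (2, 9); (4, 6); (4, 9)])]%N.

Definition in_F (G : simple_graph) : Prop :=
  exists n L S (W : set G),
    [/\ (n, L) \in F_patterns, {subset S <= L} &
        isomorphic (induced W) (chorded_cycle n S)].

Section Hyperbolicity.
Variables (R : realType) (X : metricType R).

Definition geodesic_segment (x y : X) (A : set X) : Prop :=
  exists g : R -> X,
    [/\ g 0 = x, g (mdist x y) = y,
        {in `[0, mdist x y] &, forall s t, mdist (g s) (g t) = `|s - t|} &
        A = g @` `[0, mdist x y]].

(** A geodesic triangle is represented by its three sides. *)
Definition geodesic_triangle (x1 x2 x3 : X) (A B C : set X) : Prop :=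
  [/\ geodesic_segment x1 x2 A, geodesic_segment x2 x3 B &
      geodesic_segment x3 x1 C].

Definition dist_set (p : X) (A : set X) : \bar R :=
  ereal_inf [set (mdist p q)%:E | q in A].

Definition thin (r : R) (A B C : set X) : Prop :=
  [/\ forall p, A p -> (dist_set p (B `|` C) <= r%:E)%E,
      forall p, B p -> (dist_set p (C `|` A) <= r%:E)%E &
      forall p, C p -> (dist_set p (A `|` B) <= r%:E)%E].

Definition triangle_delta (A B C : set X) : \bar R :=
  ereal_inf [set r%:E | r in [set r : R | 0 <= r /\ thin r A B C]].

Definition delta : \bar R :=
  ereal_sup [set e | exists x1 x2 x3 A B C,
    geodesic_triangle x1 x2 x3 A B C /\ e = triangle_delta A B C].

Definition diam : \bar R :=
  ereal_sup [set e | exists x y : X, e = (mdist x y)%:E].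

End Hyperbolicity.

Section Realization.
Variables (R : realType) (G : graph).

Definition vertex_coord (v : G) : G -> R := fun w => `[< w = v >]%:R.

(** Barycentric coordinates of the point of the edge [u, v] at distance [t]
    from [u]: two parametrizations of the same point give equal functions. *)
Definition edge_coord (u v : G) (t : R) : G -> R :=
  fun w => (1 - t) * vertex_coord u w + t * vertex_coord v w.

Record realization := Realization {
  coord : G -> R;
  coordP : (exists v, coord = vertex_coord v) \/
           (exists u v t, [/\ adj u v, 0 <= t <= 1 & coord = edge_coord u v t]) }.

HB.instance Definition _ := gen_eqMixin realization.
HB.instance Definition _ := gen_choiceMixin realization.

(** [route x y l]: there is a path of length [l] from [x] to [y], made of
    finitely many segments each contained in an edge. *)
Inductive route : realization -> realization -> R -> Prop :=
| route_nil x : route x x 0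
| route_step u v s t x y z l :
    adj u v -> 0 <= s <= 1 -> 0 <= t <= 1 ->
    coord x = edge_coord u v s -> coord y = edge_coord u v t ->
    route y z l -> route x z (`|s - t| + l).

Definition graph_dist (x y : realization) : R := inf [set l | route x y l].

Lemma coord_inj : injective coord.
Proof.
case=> f hf [g hg] /= fg; subst g.
by congr Realization; exact: Prop_irrelevance.
Qed.

Lemma route_ge0 x y l : route x y l -> 0 <= l.
Proof. by elim=> // *; rewrite addr_ge0. Qed.

Lemma route_trans x y z l m : route x y l -> route y z m -> route x z (l + m).
Proof.
move=> xy; elim: xy z m => [*|u v s t x1 x2 x3 k uv s01 t01 hx hy _ IH z m hm].
  by rewrite add0r.
by rewrite -addrA; apply: route_step uv s01 t01 hx hy (IH _ _ hm).
Qed.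

Lemma route_sym x y l : route x y l -> route y x l.
Proof.
elim=> [*|u v s t x1 x2 x3 k uv s01 t01 hx hy _ IH]; first exact: route_nil.
rewrite addrC -[`|s - t|]addr0 distrC; apply: route_trans IH _.
exact: route_step uv t01 s01 hy hx (route_nil _).
Qed.

Lemma coord_route x y l w : route x y l -> `|coord x w - coord y w| <= l.
Proof.
elim=> [z|u v s t x1 x2 x3 k uv s01 t01 hx hy _ IH]; first by rewrite subrr normr0.
rewrite (le_trans (ler_distD (coord x2 w) _ _))// lerD// hx hy /edge_coord.
have -> : (1 - s) * vertex_coord u w + s * vertex_coord v w -
          ((1 - t) * vertex_coord u w + t * vertex_coord v w) =
          (s - t) * (vertex_coord v w - vertex_coord u w) by ring.
rewrite normrM ler_piMr// /vertex_coord.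
case: asboolP; case: asboolP => _ _ /=;
  by rewrite ?subrr ?subr0 ?sub0r ?normrN ?normr0 ?normr1.
Qed.

Lemma vertex_coord_edge u v : @vertex_coord u = edge_coord u v 0.
Proof. by apply/funext => w; rewrite /edge_coord subr0 mul1r mul0r addr0. Qed.

Lemma vertex_coord_edge1 u v : @vertex_coord v = edge_coord u v 1.
Proof. by apply/funext => w; rewrite /edge_coord subrr mul1r mul0r add0r. Qed.

Definition vertex_point (v : G) : realization :=
  Realization (or_introl (ex_intro _ v erefl)).

Lemma route_vertex x : exists v l, route x (vertex_point v) l.
Proof.
case: (coordP x) => [[v xv]|[u [v [t [uv t01 xE]]]]].
  exists v, 0; suff -> : x = vertex_point v by exact: route_nil.
  exact: coord_inj.
exists u, (`|t - 0| + 0); apply: route_step uv t01 _ xE _ (route_nil _).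
  by rewrite lexx ler01.
exact: vertex_coord_edge.
Qed.

Lemma route_connected x y : exists l, route x y l.
Proof.
have [u [k xu]] := route_vertex x; have [v [m yv]] := route_vertex y.
suff [l uv] : exists l, route (vertex_point u) (vertex_point v) l.
  by exists (k + (l + m)); exact: route_trans xu (route_trans uv (route_sym yv)).
elim: (graph_connected u v) => [a b ab|a|a b c _ [l ab] _ [l' bc]].
- exists (`|0 - 1| + 0); apply: route_step ab _ _ _ _ (route_nil _).
  + by rewrite lexx ler01.
  + by rewrite lexx ler01.
  + exact: vertex_coord_edge.
  + exact: vertex_coord_edge1.
- by exists 0; exact: route_nil.
- by exists (l + l'); exact: route_trans ab bc.
Qed.

Lemma graph_dist_le x y l : route x y l -> graph_dist x y <= l.
Proof.
by move=> xy; apply: ge_inf => //; exists 0 => k /= /route_ge0.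
Qed.

Lemma graph_dist_ge x y (m : R) :
  (forall l, route x y l -> m <= l) -> m <= graph_dist x y.
Proof.
move=> h; apply: lb_le_inf; last by move=> l /= /h.
by have [l] := route_connected x y; exists l.
Qed.

Lemma graph_distxx x : graph_dist x x = 0.
Proof.
apply/eqP; rewrite eq_le graph_dist_le; last exact: route_nil.
by apply: graph_dist_ge => l /route_ge0.
Qed.

Lemma graph_dist_eq0 x y : graph_dist x y = 0 -> x = y.
Proof.
move=> xy0; apply: coord_inj; apply/funext => w; apply/eqP.
rewrite -subr_eq0 -normr_le0 -xy0; apply: graph_dist_ge => l; exact: coord_route.
Qed.

Lemma graph_dist_sym x y : graph_dist x y = graph_dist y x.
Proof.
by congr inf; apply/seteqP; split => l /=; exact: route_sym.
Qed.

Lemma graph_dist_triangle y x z :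
  graph_dist x z <= graph_dist x y + graph_dist y z.
Proof.
rewrite -lerBlDr; apply: graph_dist_ge => l xy.
rewrite lerBlDr -lerBlDl; apply: graph_dist_ge => m yz.
by rewrite lerBlDl; apply: graph_dist_le; exact: route_trans xy yz.
Qed.

HB.instance Definition _ := isMetric.Build R realization
  graph_distxx graph_dist_eq0 graph_dist_sym graph_dist_triangle.

End Realization.

(* Main.v *)
(** Bounds from above.  A geodesic of [lexprod G1 G2] with three consecutive
    vertices U, M, W in distinct layers projects to a path u - m - w of the tree
    G1, so a path from its start to its end has to cross from layer u to layer m
    and comes within 1 of M; when U and W share a layer the geodesic has length
    at most 3.  Both cases give 3/2.  The crossing is detected by the intermediate
    value theorem, applied to the piecewise linear extension of the indicator of
    the component of u in G1 minus m; the same function shows that trees are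
    0-hyperbolic.  If vertices are at distance at most 2, a point p at distance
    more than 5/4 from the two other sides lies on a side x U M W y with p within
    1/4 of M, and the other sides avoid all neighbours of M.  This confines
    everything to a single layer, and a shortest path from the second end of the
    edge of x to that of y in what remains closes up, with U, M, W, one of the
    chorded cycles of F.

    Bounds from below come from explicit geodesic triangles. *)

From HB Require Import structures.
From mathcomp Require Import all_boot all_order all_algebra.
From mathcomp Require Import mathcomp_extra boolp classical_sets functions.
From mathcomp Require Import reals ereal topology normedtype ring lra.
Require Import Defs.

Set Implicit Arguments.
Unset Strict Implicit.
Unset Printing Implicit Defensive.

Import Order.TTheory GRing.Theory Num.Theory.
Import numFieldNormedType.Exports.

Local Open Scope classical_set_scope.
Local Open Scope ring_scope.

(** * Geodesic metric spaces *)

(** In the chorded cycles $v_3$ is M, $v_2$ and $v_4$ are U and W, and $v_1$, $v_5$ are the other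
    ends of the edges carrying x and y; the remaining vertices lie on the two sides through z. A
    neighbour of M on those sides would be too close to p, so $v_3$ has no chord. A chord at $v_1$
    or $v_5$, or among the remaining vertices, leads to a shorter cycle of the family. Only $v_2$
    and $v_4$ can have chords, and only those that leave the sides through z geodesic.

    The constant 5/4: when vertices are at distance at most 2, a side longer than 5/2 has length
    $2+r+s$ with $r,s\le 1/2$, and M is at distance $1+r$ and $1+s$ from its ends. This is where 1/4
    comes from, and $5/4=1+1/4$ then puts the neighbours of M out of reach.

    The distance between points is an infimum over routes, not a minimum. [mdist_edge] recovers from
    it that an edge is entered through one of its ends, and most of the geometry rests on this. *)

Section GeodesicSpaces.
Variables (R : realType) (X : metricType R).
Implicit Types (x y z p q : X) (A B C : set X) (r : R).

Local Notation d := (@mdist R X).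

Lemma geodesic_refl x : geodesic_segment x x [set x].
Proof.
exists (fun=> x); rewrite mdistxx; split => // [s t|].
  rewrite !in_itv/= => /andP[s0 s1] /andP[t0 t1]; rewrite ?mdistxx.
  have -> : s = t by lra.
  by rewrite subrr normr0.
apply/seteqP; split => [_ ->|_ [s _ <-]] //.
by exists 0 => //=; rewrite in_itv/= lexx.
Qed.

Lemma geodesic_sym x y A : geodesic_segment x y A -> geodesic_segment y x A.
Proof.
move=> [g [g0 g1 gi ->]]; exists (fun t => g (d x y - t)).
rewrite (metric_sym y x) subr0 subrr; split => // [s t|].
  rewrite !in_itv/= => /andP[s0 s1] /andP[t0 t1]; rewrite gi ?in_itv/=; try lra.
  by rewrite distrC; congr `|_|; lra.
apply/seteqP; split => q [t /=]; rewrite in_itv/= => /andP[t0 t1] <-;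
  by exists (d x y - t); rewrite /= ?in_itv/= ?subKr//; lra.
Qed.

Lemma geodesic_left x y A : geodesic_segment x y A -> A x.
Proof.
by case=> g [g0 _ _ ->]; exists 0 => //=; rewrite in_itv/= lexx mdist_ge0.
Qed.

Lemma geodesic_right x y A : geodesic_segment x y A -> A y.
Proof. by move=> /geodesic_sym /geodesic_left. Qed.

Lemma geodesic_between x y A q :
  geodesic_segment x y A -> A q -> d x q + d q y = d x y.
Proof.
case=> g [<- g1 gi ->] [t /=]; rewrite in_itv/= => /andP[t0 t1] <-.
set L := d _ y in g1 gi t1 *; rewrite -[in d _ y]g1.
rewrite !gi ?in_itv/= ?lexx ?t0 ?t1 ?(le_trans t0 t1)// sub0r normrN.
by rewrite ger0_norm// distrC ger0_norm; lra.
Qed.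

Lemma geodesic_cat x y z A B :
  geodesic_segment x y A -> geodesic_segment y z B ->
  d x y + d y z <= d x z -> geodesic_segment x z (A `|` B).
Proof.
move=> [f [f0 f1 fi ->]] [g [g0 g1 gi ->]] xyz.
have dxz : d x z = d x y + d y z by apply/le_anti; rewrite xyz metric_triangle.
have dxy0 := mdist_ge0 x y; have dyz0 := mdist_ge0 y z.
pose h t := if t <= d x y then f t else g (t - d x y).
have hf t : t <= d x y -> h t = f t by rewrite /h => ->.
have hg t : d x y <= t -> h t = g (t - d x y).
  rewrite /h le_eqVlt => /orP[/eqP<-|]; first by rewrite lexx subrr f1 g0.
  by rewrite ltNge => /negbTE ->.
(* Points on different pieces: the route through [y] bounds their distance from above, and a shorter
   one would make [d x z] smaller than [d x y + d y z]. *)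
have hmix s t : 0 <= s -> s <= d x y -> d x y <= t -> t <= d x z ->
    d (h s) (h t) = t - s.
  move=> s0 s1 t0 t1; rewrite (hf s s1) (hg t t0).
  have h5 : d (f s) y = d x y - s.
    by rewrite -[y in LHS]f1 fi ?in_itv/= ?[`|_ - _|]ler0_norm//; lra.
  have h6 : d y (g (t - d x y)) = t - d x y.
    by rewrite -{1}g0 gi ?in_itv/= ?[`|_ - _|]ler0_norm//; lra.
  have h0 := metric_triangle (f s) y (g (t - d x y)).
  have h1 := metric_triangle x (f s) z.
  have h2 := metric_triangle (f s) (g (t - d x y)) z.
  have h3 : d x (f s) = s.
    by rewrite -[x in LHS]f0 fi ?in_itv/= ?sub0r ?normrN ?ger0_norm//; lra.
  have h4 : d (g (t - d x y)) z = d y z - (t - d x y).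
    by rewrite -[z in LHS]g1 gi ?in_itv/= ?[`|_ - _|]ler0_norm//; lra.
  by apply/le_anti/andP; split; lra.
exists h; split.
- by rewrite hf.
- by rewrite dxz hg ?lerDl// addrAC subrr add0r.
- move=> s t; rewrite !in_itv/= => /andP[s0 s1] /andP[t0 t1].
  have [sl|sl] := leP s (d x y); have [tl|tl] := leP t (d x y).
  + by rewrite !hf// fi ?in_itv//=; lra.
  + by rewrite hmix 1?distrC ?ger0_norm//; lra.
  + by rewrite metric_sym hmix ?ger0_norm//; lra.
  + rewrite !hg ?gi ?in_itv/=; try lra.
    by congr `|_|; lra.
- apply/seteqP; split => [q [[t]|[t]]|q [t]] /=; rewrite in_itv/= => /andP[t0 t1] <-.
  + by exists t; rewrite /= ?in_itv/= ?hf//; lra.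
  + exists (t + d x y); first by rewrite /= in_itv/=; lra.
    by rewrite hg ?addrK//; lra.
  + have [tl|tl] := leP t (d x y).
      by left; exists t; rewrite /= ?in_itv/= ?hf//; lra.
    by right; exists (t - d x y); rewrite /= ?in_itv/= ?hg//; lra.
Qed.

End GeodesicSpaces.

Section DeltaBounds.
Variables (R : realType) (X : metricType R).
Implicit Types (x y z p q : X) (A B C Q : set X) (r : R).

Local Notation d := (@mdist R X).

Lemma dist_set_le p Q (q : X) r : Q q -> d p q <= r -> (dist_set p Q <= r%:E)%E.
Proof.
move=> Qq pq; apply: (@le_trans _ _ (d p q)%:E); last by rewrite lee_fin.
by apply: ereal_inf_lbound; exists q.
Qed.

Lemma dist_set_approx p Q r :
  (forall e, 0 < e -> exists2 q, Q q & d p q <= r + e) -> (dist_set p Q <= r%:E)%E.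
Proof.
move=> h; apply/lee_addgt0Pr => e e0; have [q Qq qe] := h e e0.
by rewrite -EFinD; exact: dist_set_le Qq qe.
Qed.

(** The distance to a set is an infimum, so its failure to be at most [r] leaves a margin [e]
    uniform in [q]. The bound 3/2 spends this margin on a point that only nearly reaches the layer
    of U. *)
Lemma dist_set_far p Q r : ~ (dist_set p Q <= r%:E)%E ->
  exists2 e, 0 < e & forall q, Q q -> r + e < d p q.
Proof.
move=> h; apply: contrapT => nh; apply: h; apply: dist_set_approx => e e0.
apply: contrapT => nq; apply: nh; exists e => // q Qq.
by rewrite ltNge; apply/negP => pq; apply: nq; exists q.
Qed.

Lemma geodesic_triangle_rot x y z A B C :
  geodesic_triangle x y z A B C -> geodesic_triangle y z x B C A.
Proof. by case. Qed.

Lemma delta_le r : 0 <= r ->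
  (forall x y z A B C p, geodesic_triangle x y z A B C -> A p ->
    (dist_set p (B `|` C) <= r%:E)%E) ->
  (delta X <= r%:E)%E.
Proof.
move=> r0 h; apply: ge_ereal_sup => e [x [y [z [A [B [C [T ->]]]]]]].
apply: ereal_inf_lbound; exists r => //; split => //; split => p; first exact: h T.
- exact: h (geodesic_triangle_rot T).
- exact: h (geodesic_triangle_rot (geodesic_triangle_rot T)).
Qed.

Lemma delta_ge x y z A B C p r : geodesic_triangle x y z A B C -> A p ->
  (forall q, B q \/ C q -> r <= d p q) -> (r%:E <= delta X)%E.
Proof.
move=> T Ap h; apply: (@le_trans _ _ (triangle_delta A B C)); last first.
  by apply: ereal_sup_ubound; exists x, y, z, A, B, C.
apply: le_ereal_inf_tmp => _ [s [_ [/(_ p Ap) + _ _]] <-]; apply: le_trans.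
by apply: le_ereal_inf_tmp => _ [q Qq <-]; rewrite lee_fin; exact: h.
Qed.

(** The third side of the triangle is the constant geodesic at [y], which lies on [B]. *)
Lemma delta_ge_bigon x y A B p r : geodesic_segment x y A -> geodesic_segment x y B ->
  A p -> (forall q, B q -> r <= d p q) -> (r%:E <= delta X)%E.
Proof.
move=> hA hB Ap h; have T : geodesic_triangle x y y A [set y] B.
  by split; [| exact: geodesic_refl | exact: geodesic_sym].
by apply: (delta_ge T Ap) => q [->|]; apply: h; exact: geodesic_right hB.
Qed.

Lemma delta_ge0 x : (0 <= delta X)%E.
Proof.
apply: (delta_ge_bigon (geodesic_refl x) (geodesic_refl x) (p := x)) => // q ->.
by rewrite mdistxx.
Qed.

Lemma delta_le_half_diam r : (forall x y, d x y <= r + r) -> (delta X <= r%:E)%E.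
Proof.
move=> h; have [[x _]|X0] := pselect (exists x : X, True); last first.
  by apply: ge_ereal_sup => e [x _]; case: X0; exists x.
have r0 : 0 <= r by have := h x x; rewrite mdistxx; lra.
apply: delta_le => // {}x y z A B C p [hA hB hC] Ap.
have := geodesic_between hA Ap; have := h x y.
have [pr|pr] := leP (d x p) r => ? ?.
  by apply: (@dist_set_le _ _ x); [right; exact: geodesic_right hC | rewrite metric_sym].
by apply: (@dist_set_le _ _ y); [left; exact: geodesic_left hB | lra].
Qed.

(** Working form of [geodesic_segment]: the distance to [x] becomes a coordinate along [A], so that
    points of [A] can be named by reals. *)
Lemma geodesic_param x y A : geodesic_segment x y A ->
  exists g : R -> X, [/\ g 0 = x, g (d x y) = y,
    (forall s t, 0 <= s -> s <= d x y -> 0 <= t -> t <= d x y ->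
      d (g s) (g t) = `|s - t|),
    (forall t, 0 <= t -> t <= d x y -> A (g t)) &
    (forall q, A q -> g (d x q) = q)].
Proof.
case=> g [g0 g1 gi AE]; exists g; split=> // [s t s0 s1 t0 t1|t t0 t1|q].
- by apply: gi; rewrite in_itv/= ?s0 ?t0.
- by rewrite AE; exists t => //=; rewrite in_itv/= t0.
- rewrite AE => -[t /=]; rewrite in_itv/= => /andP[t0 t1] <-; congr g.
  rewrite -[X in d X _]g0 gi ?in_itv/= ?lexx ?t0 ?t1 ?mdist_ge0//.
  by rewrite sub0r normrN ger0_norm.
Qed.

Lemma geodesic_IVT (h : X -> R) x y A r : geodesic_segment x y A ->
  (forall p q, `|h p - h q| <= d p q) -> h x <= r <= h y ->
  exists2 q, A q & h q = r.
Proof.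
move=> /geodesic_param[g [g0 g1 gi gA _]] hl hr.
have d0 := mdist_ge0 x y.
(* [g] is controlled only on the segment; clamping the parameter, a 1-Lipschitz map, gives a
   function continuous on the whole line. *)
pose c t := Num.max 0 (Num.min t (d x y)).
have c01 t : 0 <= c t /\ c t <= d x y.
  rewrite /c; have [tL|tL] := leP t (d x y); last by rewrite (max_r d0); split; lra.
  by have [t0|t0] := leP 0 t; split; lra.
have cl s t : `|c s - c t| <= `|s - t|.
  wlog st : s t / s <= t => [hw|].
    by have [/hw//|/ltW/hw] := leP s t; rewrite distrC [X in _ <= X]distrC.
  rewrite (@ler0_norm _ (s - t)) ?ler_norml; last by lra.
  rewrite /c; have [tL|tL] := leP t (d x y); last first.
    by have [sL|sL] := leP s (d x y); [have [s0|s0] := leP 0 s|]; rewrite (max_r d0); lra.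
  rewrite (min_l (le_trans st tL)).
  by have [s0|s0] := leP 0 s; have [t0|t0] := leP 0 t; lra.
have cE t : 0 <= t -> t <= d x y -> c t = t.
  by rewrite /c => t0 t1; rewrite (min_l t1) (max_r t0).
have hc : continuous (fun t => h (g (c t))).
  move=> t; apply/cvgrPdist_le => /= e e0.
  apply: filterS (nbhs_ball_norm t (PosNum e0)) => s /= ts.
  apply: le_trans (hl _ _) _; rewrite gi ?(c01 _).1 ?(c01 _).2//.
  exact: le_trans (cl _ _) (ltW ts).
have [|t] := @IVT R (fun t => h (g (c t))) 0 (d x y) r d0 (continuous_subspaceT hc).
  rewrite !cE ?lexx// g0 g1; have hxy : h x <= h y by lra.
  by rewrite (min_l hxy) (max_r hxy).
rewrite in_itv/= => /andP[t0 t1] <-; exists (g (c t)) => //.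
by rewrite cE//; exact: gA.
Qed.

End DeltaBounds.

(** * Isometric embeddings *)

Section IsometricEmbedding.
Variables (R : realType) (X Y : metricType R) (F : X -> Y).
Hypothesis isoF : forall x y, mdist (F x) (F y) = mdist x y.

Lemma isometry_geodesic x y A :
  geodesic_segment x y A -> geodesic_segment (F x) (F y) (F @` A).
Proof.
case=> g [g0 g1 gi ->]; exists (F \o g); rewrite isoF /= g0 g1; split=> //.
- by move=> s t hs ht; rewrite /= isoF gi.
- by rewrite image_comp.
Qed.

Lemma isometry_dist_set p A : dist_set (F p) (F @` A) = dist_set p A.
Proof.
rewrite /dist_set; congr ereal_inf; apply/seteqP; split=> [_ [_ [q Aq <-] <-]|_ [q Aq <-]].
  by exists q => //; rewrite isoF.
by exists (F q); [exists q | rewrite isoF].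
Qed.

Lemma isometry_thin r A B C : thin r A B C -> thin r (F @` A) (F @` B) (F @` C).
Proof.
by move=> [h1 h2 h3]; split=> _ [q hq <-]; rewrite -image_setU isometry_dist_set;
  [apply: h1|apply: h2|apply: h3].
Qed.

Lemma thin_isometry r A B C : thin r (F @` A) (F @` B) (F @` C) -> thin r A B C.
Proof.
by move=> [h1 h2 h3]; split=> q hq; rewrite -isometry_dist_set image_setU;
  [apply: h1|apply: h2|apply: h3]; exists q.
Qed.

Lemma isometry_delta_le : (delta X <= delta Y)%E.
Proof.
apply: ge_ereal_sup => e [x [y [z [A [B [C [[hA hB hC] ->]]]]]]].
apply: ereal_sup_ubound; exists (F x), (F y), (F z), (F @` A), (F @` B), (F @` C).
split; first by split; exact: isometry_geodesic.
rewrite /triangle_delta; congr ereal_inf; apply/seteqP.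
by split=> _ [r [r0 hr] <-]; exists r => //; split=> //;
  [exact: isometry_thin | exact: thin_isometry].
Qed.

End IsometricEmbedding.

(** * Metric graphs *)

Inductive walk (G : simple_graph) : G -> G -> nat -> Prop :=
| walk_nil u : walk u u 0
| walk_cons u v w n : adj u v -> walk v w n -> walk u w n.+1.

Lemma walk_cat (G : simple_graph) (u v w : G) m n :
  walk u v m -> walk v w n -> walk u w (m + n).
Proof. by elim=> // a b c k ab _ IH /IH; exact: walk_cons. Qed.

Lemma walk1 (G : simple_graph) (u v : G) : adj u v -> walk u v 1.
Proof. by move=> uv; exact: walk_cons uv (walk_nil _). Qed.

Lemma walk_connected (G : graph) (u v : G) : exists n, walk u v n.
Proof.
elim: (graph_connected u v) => [a b ab|a|a b c _ [m am] _ [n bn]].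
- by exists 1; exact: walk1.
- by exists 0; exact: walk_nil.
- by exists (m + n)%N; exact: walk_cat am bn.
Qed.

Section EdgePoints.
Variables (R : realType) (G : graph).
Implicit Types (u v w a b : G) (p q x y : realization R G) (s t : R).

Local Notation V := (@vertex_point R G).
Local Notation d := (@mdist R (realization R G)).

Definition on_edge q u v t := [/\ adj u v, 0 <= t <= 1 & coord q = edge_coord u v t].

Lemma edge_coord_sym u v t : edge_coord u v t = edge_coord v u (1 - t) :> (G -> R).
Proof. by apply/funext => w; rewrite /edge_coord; ring. Qed.

Lemma on_edge_sym q u v t : on_edge q u v t -> on_edge q v u (1 - t).
Proof.
case=> uv t01 qE; split; [exact: adj_sym | lra |].
by rewrite qE edge_coord_sym.
Qed.

Lemma on_edge_ge0 q u v t : on_edge q u v t -> 0 <= t.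
Proof. by case=> _ /andP[]. Qed.

Lemma on_edge_le1 q u v t : on_edge q u v t -> t <= 1.
Proof. by case=> _ /andP[]. Qed.

Lemma on_edge_ex u v t : adj u v -> 0 <= t -> t <= 1 -> exists q, on_edge q u v t.
Proof.
move=> uv t0 t1.
have t01 : 0 <= t <= 1 by rewrite t0.
by exists (Realization (or_intror (ex_intro _ u (ex_intro _ v
  (ex_intro _ t (And3 uv t01 (erefl (edge_coord u v t)))))))).
Qed.

Lemma on_edge_inj q q' u v t : on_edge q u v t -> on_edge q' u v t -> q = q'.
Proof. by case=> _ _ qE [_ _ q'E]; apply: coord_inj; rewrite qE q'E. Qed.

Lemma vertex_coordE v w : vertex_coord R v w = `[< w = v >]%:R.
Proof. by []. Qed.

Lemma adj_neq u v : adj u v -> u <> v.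
Proof. by move=> + uv; rewrite uv => /adj_irrefl. Qed.

Lemma edge_coord_left u v t : adj u v -> edge_coord u v t u = 1 - t.
Proof.
move=> uv; rewrite /edge_coord !vertex_coordE (asboolT (erefl u)) asboolF.
  by rewrite mulr1 mulr0 addr0.
exact: adj_neq.
Qed.

Lemma edge_coord_right u v t : adj u v -> edge_coord u v t v = t.
Proof.
by move=> uv; rewrite edge_coord_sym edge_coord_left ?subKr//; exact: adj_sym.
Qed.

Lemma edge_coord_out u v w t : w <> u -> w <> v -> edge_coord u v t w = 0.
Proof.
by move=> wu wv; rewrite /edge_coord !vertex_coordE !asboolF// !mulr0 addr0.
Qed.

Lemma on_edge_uniq q u v s t : on_edge q u v s -> on_edge q u v t -> s = t.
Proof.
case=> uv _ qs [_ _ qt]; rewrite -(edge_coord_right s uv) -[RHS](edge_coord_right t uv).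
by rewrite -qs -qt.
Qed.

Lemma on_edge_left u v : adj u v -> on_edge (V u) u v 0.
Proof. by move=> uv; split=> //; [rewrite lexx ler01 | exact: vertex_coord_edge]. Qed.

Lemma on_edge_right u v : adj u v -> on_edge (V v) u v 1.
Proof. by move=> uv; split=> //; [rewrite lexx ler01 | exact: vertex_coord_edge1]. Qed.

Lemma on_edge0 q u v : on_edge q u v 0 -> q = V u.
Proof. by move=> h; have [uv _ _] := h; exact: on_edge_inj h (on_edge_left uv). Qed.

Lemma on_edge1 q u v : on_edge q u v 1 -> q = V v.
Proof. by move=> h; have [uv _ _] := h; exact: on_edge_inj h (on_edge_right uv). Qed.

Lemma vertex_point_inj : injective V.
Proof.
move=> u v [] /(congr1 (fun f => f u)); rewrite !vertex_coordE asboolT//.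
by case: asboolP => // _ /eqP; rewrite oner_eq0.
Qed.

Lemma on_edge_vertex w u v t : on_edge (V w) u v t ->
  w = u /\ t = 0 \/ w = v /\ t = 1.
Proof.
move=> h; have [uv _ wE] := h.
have [wu|wu] := pselect (w = u).
  left; split=> //; apply: on_edge_uniq h _; rewrite wu; exact: on_edge_left.
have [wv|wv] := pselect (w = v).
  right; split=> //; apply: on_edge_uniq h _; rewrite wv; exact: on_edge_right.
have /eqP := congr1 (fun f => f w) wE; rewrite /= vertex_coordE asboolT//.
by rewrite edge_coord_out// oner_eq0.
Qed.

(** The support of the barycentric coordinates of an interior point is the pair of ends of its edge,
    so only vertices can lie on two different edges. *)
Lemma on_edge_cases q u v s a b t : on_edge q u v s -> on_edge q a b t ->
  [\/ [/\ u = a, v = b & s = t], [/\ u = b, v = a & s = 1 - t] |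
      q = V u /\ s = 0 \/ q = V v /\ s = 1].
Proof.
move=> qs qt; have [uv /andP[s0 s1] qE] := qs; have [ab _ qE'] := qt.
have [s00|s00] := eqVneq s 0.
  by constructor 3; left; split=> //; apply: (@on_edge0 q u v); rewrite -s00.
have [s11|s11] := eqVneq s 1.
  by constructor 3; right; split=> //; apply: (@on_edge1 q u v); rewrite -s11.
have hin w : coord q w != 0 -> w = a \/ w = b.
  move=> h; have [wa|wa] := pselect (w = a); first by left.
  have [wb|wb] := pselect (w = b); first by right.
  by rewrite qE' edge_coord_out ?eqxx in h.
have hu : u = a \/ u = b.
  by apply: hin; rewrite qE edge_coord_left// subr_eq0 eq_sym.
have hv : v = a \/ v = b by apply: hin; rewrite qE edge_coord_right.
have nuv := adj_neq uv.
case: hu hv => ? [] ?; subst => //.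
  by constructor 1; split=> //; exact: on_edge_uniq qt.
by constructor 2; split=> //; apply: on_edge_uniq qs (on_edge_sym qt).
Qed.

Lemma mdist_on_edge_le p q u v s t :
  on_edge p u v s -> on_edge q u v t -> d p q <= `|s - t|.
Proof.
move=> [uv s01 pE] [_ t01 qE]; rewrite -[X in _ <= X]addr0; apply: graph_dist_le.
exact: route_step uv s01 t01 pE qE (route_nil _).
Qed.

Lemma mdist_left q u v t : on_edge q u v t -> d (V u) q <= t.
Proof.
move=> h; have [uv /andP[t0 _] _] := h.
by have := mdist_on_edge_le (on_edge_left uv) h; rewrite sub0r normrN ger0_norm.
Qed.

Lemma mdist_right q u v t : on_edge q u v t -> d (V v) q <= 1 - t.
Proof. by move/on_edge_sym/mdist_left. Qed.

Lemma mdist_le_left p q u v t : on_edge q u v t -> d p q <= d p (V u) + t.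
Proof. by move/mdist_left => h; have := metric_triangle p (V u) q; lra. Qed.

Lemma mdist_le_right p q u v t : on_edge q u v t -> d p q <= d p (V v) + (1 - t).
Proof. by move/on_edge_sym/mdist_le_left. Qed.

(** A shortest way from [p] to a point of an edge comes in through [u], through [v], or starts on
    that edge. Since no route need be known to attain the distance, each route is bounded below by
    one of the three lengths and the bounds are passed to the infimum. *)
Lemma mdist_edge p q u v t : on_edge q u v t ->
  [\/ d p q = d p (V u) + t, d p q = d p (V v) + (1 - t) |
      exists2 s, on_edge p u v s & d p q = `|s - t|].
Proof.
move=> qt.
have key l : route q p l -> [\/ d p (V u) + t <= l, d p (V v) + (1 - t) <= l |
    exists2 s, on_edge p u v s & `|s - t| <= l].
  move=> h; elim: h u v t qt => {q p l} [q|a b s t' q q1 p l ab s01 t01 qE q1E r IH] u v t qt.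
    by constructor 3; exists t => //; rewrite subrr normr0.
  have qs : on_edge q a b s by [].
  have q1t : on_edge q1 a b t' by [].
  have dq : d p q <= `|s - t'| + l.
    rewrite metric_sym; apply: graph_dist_le; exact: route_step ab s01 t01 qE q1E r.
  have [[ua vb ts]|[ub va ts]|[[qu t0]|[qv t1]]] := on_edge_cases qt qs.
  - have [h|h|[s' ps' h]] := IH _ _ _ q1t.
    + by constructor 1; rewrite ua ts; have := ler_norm (s - t'); lra.
    + by constructor 2; rewrite vb ts distrC; have := ler_norm (t' - s); lra.
    + constructor 3; exists s'; rewrite ?ua ?vb// ts.
      by have := ler_distD t' s' s; rewrite [`|t' - s|]distrC; lra.
  - have [h|h|[s' ps' h]] := IH _ _ _ q1t.
    + by constructor 2; rewrite va ts subKr; have := ler_norm (s - t'); lra.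
    + by constructor 1; rewrite ub ts distrC; have := ler_norm (t' - s); lra.
    + constructor 3; exists (1 - s'); rewrite ?ub ?va ?ts; first exact: on_edge_sym.
      have -> : 1 - s' - (1 - s) = s - s' by ring.
      by have := ler_distD t' s' s; rewrite [`|t' - s|]distrC [`|s - s'|]distrC; lra.
  - by constructor 1; rewrite -qu t0 addr0.
  - by constructor 2; rewrite -qv t1 subrr addr0.
have h1 := mdist_le_left p qt; have h2 := mdist_le_right p qt.
have [->|n1] := eqVneq (d p q) (d p (V u) + t); first by constructor 1.
have [->|n2] := eqVneq (d p q) (d p (V v) + (1 - t)); first by constructor 2.
have {n1}h1 : d p q < d p (V u) + t by rewrite lt_neqAle n1.
have {n2}h2 : d p q < d p (V v) + (1 - t) by rewrite lt_neqAle n2.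
(* If neither end realizes the distance, it is strictly below [m], so [p] must lie on the edge
   itself. *)
pose m := Num.min (d p (V u) + t) (d p (V v) + (1 - t)).
have hm : d p q < m by rewrite lt_min h1.
have mu : m <= d p (V u) + t by rewrite ge_min lexx.
have mv : m <= d p (V v) + (1 - t) by rewrite ge_min lexx orbT.
have rs l : route p q l -> route q p l by exact: route_sym.
have [[s ps]|ns] := pselect (exists s, on_edge p u v s).
  constructor 3; exists s => //; have h3 := mdist_on_edge_le ps qt.
  apply/le_anti; rewrite h3 leNgt; apply/negP => h4.
  pose m' := Num.min m `|s - t|.
  have m'm : m' <= m by rewrite ge_min lexx.
  have m's : m' <= `|s - t| by rewrite ge_min lexx orbT.
  have : m' <= d p q.
    apply: graph_dist_ge => l /rs /key[h|h|[s' ps' h]]; try lra.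
    by rewrite (on_edge_uniq ps' ps) in h; lra.
  by rewrite leNgt lt_min hm h4.
have : m <= d p q.
  apply: graph_dist_ge => l /rs /key[h|h|[s' ps' h]]; try lra.
  by case: ns; exists s'.
by rewrite leNgt hm.
Qed.

Lemma mdist_vertex_edge w q u v t : on_edge q u v t ->
  d (V w) q = d (V w) (V u) + t \/ d (V w) q = d (V w) (V v) + (1 - t).
Proof.
move=> qt; have [->|->|[s ps ->]] := mdist_edge (V w) qt; [by left|by right|].
have /andP[t0 t1] : 0 <= t <= 1 by case: qt.
have [[-> ->]|[-> ->]] := on_edge_vertex ps.
  by left; rewrite mdistxx sub0r normrN add0r ger0_norm.
by right; rewrite mdistxx add0r ger0_norm// subr_ge0.
Qed.

Lemma mdist_ge_edge p q u v t r : on_edge q u v t ->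
  r <= d p (V u) + t -> r <= d p (V v) + (1 - t) ->
  (forall s, on_edge p u v s -> r <= `|s - t|) -> r <= d p q.
Proof. by move=> /(@mdist_edge p)[->|->|[s /[swap] -> ps]] // _ _ /(_ s ps). Qed.

(** No detour beats the edge, because the coordinate at [v] is 1-Lipschitz along every route. *)
Lemma mdist_same_edge p q u v s t :
  on_edge p u v s -> on_edge q u v t -> d p q = `|s - t|.
Proof.
move=> ps qt; apply/le_anti; rewrite (mdist_on_edge_le ps qt)/=.
apply: graph_dist_ge => l /(@coord_route _ _ _ _ _ v).
by have [uv _ ->] := ps; have [_ _ ->] := qt; rewrite !edge_coord_right.
Qed.

End EdgePoints.

Section VertexDistance.
Variable G : graph.
Implicit Types u v w : G.

Lemma walk_dec_ex u v : exists n, `[< walk u v n >].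
Proof. by have [n h] := walk_connected u v; exists n; exact/asboolP. Qed.

Definition vdist u v : nat := ex_minn (walk_dec_ex u v).

Lemma vdist_walk u v : walk u v (vdist u v).
Proof. by rewrite /vdist; case: ex_minnP => n /asboolP. Qed.

Lemma vdist_le u v n : walk u v n -> (vdist u v <= n)%N.
Proof. by rewrite /vdist; case: ex_minnP => m _ + h; apply; exact/asboolP. Qed.

Lemma vdistxx u : vdist u u = 0.
Proof. by apply/eqP; rewrite -leqn0; apply: vdist_le; exact: walk_nil. Qed.

Lemma vdist_eq0 u v : vdist u v = 0 -> u = v.
Proof. by move=> h; have := vdist_walk u v; rewrite h => h'; inversion h'. Qed.

Lemma vdistS u v n : vdist u v = n.+1 -> exists2 w, adj u w & vdist w v = n.
Proof.
move=> h; have := vdist_walk u v; rewrite h => h'; inversion h' as [|a w c m uw wv].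
subst; exists w => //; apply/eqP; rewrite eqn_leq vdist_le//= -ltnS -h.
by apply: vdist_le; apply: walk_cons uw (vdist_walk _ _).
Qed.

Lemma vdist_adj u v w : adj v w -> (vdist u w <= (vdist u v).+1)%N.
Proof.
move=> vw; apply: vdist_le; rewrite -addn1.
exact: walk_cat (vdist_walk u v) (walk1 vw).
Qed.

End VertexDistance.

Section PiecewiseLinear.
Variables (R : realType) (G : graph).
Implicit Types (u v w a b : G) (p q x y : realization R G) (s t : R) (phi : G -> R).

Local Notation V := (@vertex_point R G).
Local Notation d := (@mdist R (realization R G)).

(** A point of an edge has two parametrizations, and a vertex one for each incident edge, so the
    value is picked by [xget]; the next two lemmas show that all of them give the same number. *)
Definition pl_extension phi q : R := xget 0
  [set r | (exists2 v, q = V v & r = phi v) \/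
           (exists u v t, on_edge q u v t /\ r = (1 - t) * phi u + t * phi v)].

Lemma pl_extension_edge phi q u v t : on_edge q u v t ->
  pl_extension phi q = (1 - t) * phi u + t * phi v.
Proof.
move=> qt; rewrite /pl_extension; case: xgetP => [r -> /= hr|/(_ ((1 - t) * phi u + t * phi v)) []]; last first.
  by right; exists u, v, t.
case: hr => [[w qw ->]|[a [b [s [qs ->]]]]].
  rewrite qw in qt; have [[-> ->]|[-> ->]] := on_edge_vertex qt; ring.
have [[-> -> ->]|[-> -> ->]|[[qu t0]|[qv t1]]] := on_edge_cases qt qs; first by [].
- ring.
- by rewrite qu in qs; rewrite t0; have [[<- ->]|[<- ->]] := on_edge_vertex qs; ring.
- by rewrite qv in qs; rewrite t1; have [[<- ->]|[<- ->]] := on_edge_vertex qs; ring.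
Qed.

Lemma pl_extension_vertex phi v : pl_extension phi (V v) = phi v.
Proof.
rewrite /pl_extension; case: xgetP => [r -> /= hr|/(_ (phi v)) []]; last first.
  by left; exists v.
case: hr => [[w /vertex_point_inj -> //]|[a [b [s [qs ->]]]]].
by have [[-> ->]|[-> ->]] := on_edge_vertex qs; ring.
Qed.

Lemma pl_extension_lipschitz phi p q :
  (forall u v, adj u v -> `|phi u - phi v| <= 1) ->
  `|pl_extension phi p - pl_extension phi q| <= d p q.
Proof.
move=> h1; apply: graph_dist_ge => l; elim=> [x|u v s t x y z k uv s01 t01 xE yE _ IH].
  by rewrite subrr normr0.
apply: le_trans (ler_distD (pl_extension phi y) _ _) _; apply: lerD => //.
rewrite (pl_extension_edge phi (And3 uv s01 xE)) (pl_extension_edge phi (And3 uv t01 yE)).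
have -> : (1 - s) * phi u + s * phi v - ((1 - t) * phi u + t * phi v) =
  (s - t) * (phi v - phi u) by ring.
by rewrite normrM ler_piMr// distrC h1.
Qed.

(** A shortest walk gives the upper bound. For the lower one, [vdist u] changes by at most 1 along
    an edge, so its piecewise linear extension is 1-Lipschitz. *)
Lemma mdist_vertex u v : d (V u) (V v) = (vdist u v)%:R.
Proof.
apply/le_anti/andP; split.
  elim: (vdist_walk u v) => [w|a b c n ab _ IH]; first by rewrite mdistxx.
  have := metric_triangle (V a) (V b) (V c).
  have := mdist_left (on_edge_right R ab); rewrite -[n.+1]add1n natrD; lra.
have h1 a b : adj a b -> `|(vdist u a)%:R - (vdist u b)%:R| <= 1 :> R.
  move=> ab; have h := vdist_adj u ab; have h' := vdist_adj u (adj_sym ab).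
  rewrite -(ler_nat R) -natr1 in h; rewrite -(ler_nat R) -natr1 in h'.
  by rewrite ler_norml; lra.
have := pl_extension_lipschitz (V u) (V v) h1.
by rewrite !pl_extension_vertex vdistxx sub0r normrN ger0_norm.
Qed.

Lemma mdist_adj u v : adj u v -> d (V u) (V v) = 1.
Proof.
move=> uv; rewrite mdist_vertex; have := vdist_le (walk1 uv).
case E : (vdist u v) => [|[|n]] // _.
by have := adj_neq uv; rewrite (vdist_eq0 E).
Qed.

Lemma mdist_vertex_ge1 u v : u <> v -> 1 <= d (V u) (V v).
Proof.
move=> uv; rewrite mdist_vertex ler1n lt0n; apply/eqP => /vdist_eq0; exact: uv.
Qed.

Lemma mdist_vertex_lt2 u v : d (V u) (V v) < 2 -> u = v \/ adj u v.
Proof.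
rewrite mdist_vertex ltr_nat; case E : (vdist u v) => [|[|n]] // _.
  by left; exact: vdist_eq0.
by right; have [w uw /vdist_eq0 <-] := vdistS E.
Qed.

Lemma mdist_vertex_ge2 u v : u <> v -> ~ adj u v -> 2 <= d (V u) (V v).
Proof.
by move=> nuv nauv; rewrite leNgt; apply/negP => /mdist_vertex_lt2[].
Qed.

Lemma mdist_vertex_le2 u v w : adj u v -> adj v w -> d (V u) (V w) <= 2.
Proof.
move=> uv vw; have := metric_triangle (V u) (V v) (V w).
by rewrite (mdist_adj uv) (mdist_adj vw); lra.
Qed.

Lemma mdist_vertex_le1 u v : u = v \/ adj u v -> d (V u) (V v) <= 1.
Proof. by case=> [->|/mdist_adj->] //; rewrite mdistxx. Qed.

(** The distance from a vertex to the point at parameter [t] of an edge is an integer plus [t] or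
    plus [1 - t]; if it is an integer, [t] is 0 or 1. *)
Lemma vertex_of_mdist_nat u q n : d (V u) q = n%:R -> (exists v, q = V v).
Proof.
move=> dn; have [[v qv]|[a [b [t [ab t01 qE]]]]] := coordP q.
  by exists v; exact: coord_inj.
have qt : on_edge q a b t by [].
have /andP[t0 t1] := t01.
suff [k tk] : exists k : nat, t = k%:R.
  move: tk t1 qt; case: k => [|[|k]] ->; rewrite ?ler1n//.
  + by move=> _ /on_edge0; exists a.
  + by move=> _ /on_edge1; exists b.
  + by rewrite -[X in _ <= X]/(1%:R) ler_nat.
have [|] := mdist_vertex_edge u qt; rewrite mdist_vertex dn => h.
  have kn : (vdist u a <= n)%N by rewrite -(ler_nat R) h lerDl.
  by exists (n - vdist u a)%N; rewrite natrB// h; ring.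
have kn : (n <= (vdist u b).+1)%N by rewrite -(ler_nat R) h -natr1; lra.
by exists ((vdist u b).+1 - n)%N; rewrite natrB// h -natr1; ring.
Qed.

Lemma on_some_edge u0 v0 q : adj u0 v0 -> exists u v t, on_edge q u v t.
Proof.
move=> u0v0; have [[v qv]|[a [b [t [ab t01 qE]]]]] := coordP q; last by exists a, b, t.
have -> : q = V v by exact: coord_inj.
have [vu|vu] := pselect (v = u0).
  by exists v, v0, 0; apply: on_edge_left; rewrite vu.
have := vdist_walk v u0; case E : (vdist v u0) => [|n]; first by have := vdist_eq0 E.
by have [w vw _] := vdistS E; exists v, w, 0; exact: on_edge_left.
Qed.

Lemma adj_of_mdist_gt0 p q : 0 < d p q -> exists u v : G, adj u v.
Proof.
move=> pq; apply: contrapT => h; suff pqE : p = q by rewrite pqE mdistxx ltxx in pq.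
have [l] := route_connected p q; case=> // u v *; by case: h; exists u, v.
Qed.

End PiecewiseLinear.

Lemma geodesic_sub (R : realType) (X : metricType R) (x y p : X) (A : set X) :
  geodesic_segment x y A -> A p ->
  exists2 B, geodesic_segment p y B & forall q, B q -> A q /\ mdist x p <= mdist x q.
Proof.
move=> hA Ap; have := geodesic_between hA Ap.
have [g [g0 g1 gi gA gE]] := geodesic_param hA => dxpy.
have d0 := mdist_ge0 x p; have d1 := mdist_ge0 p y.
have hdx t : 0 <= t -> t <= mdist x y -> mdist x (g t) = t.
  by move=> t0 t1; rewrite -{1}g0 gi ?sub0r ?normrN ?ger0_norm//; lra.
exists ((fun t => g (mdist x p + t)) @` `[0, mdist p y]); last first.
  move=> q [t /=]; rewrite in_itv/= => /andP[t0 t1] <-.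
  by split; [apply: gA; lra | rewrite hdx; lra].
exists (fun t => g (mdist x p + t)); split=> //.
- by rewrite addr0 gE.
- by rewrite dxpy.
- move=> s t; rewrite !in_itv/= => /andP[s0 s1] /andP[t0 t1].
  by rewrite gi; try lra; congr `|_|; ring.
Qed.

Section GeodesicsInGraphs.
Variables (R : realType) (G : graph).
Implicit Types (u v w a b : G) (p q x y : realization R G) (s t : R).
Implicit Types A B : set (realization R G).

Local Notation V := (@vertex_point R G).
Local Notation d := (@mdist R (realization R G)).

Definition edge_segment u v s t : set (realization R G) :=
  [set q | exists2 r, s <= r <= t & on_edge q u v r].

Lemma edge_segment_geodesic x y u v s t : on_edge x u v s -> on_edge y u v t ->
  s <= t -> geodesic_segment x y (edge_segment u v s t).
Proof.
move=> xs yt st; have dxy : d x y = t - s.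
  by rewrite (mdist_same_edge xs yt) distrC ger0_norm// subr_ge0.
have [uv /andP[s0 _] _] := xs; have [_ /andP[_ t1] _] := yt.
pose g r := xget x [set q | on_edge q u v (s + r)].
have gP r : 0 <= r -> r <= t - s -> on_edge (g r) u v (s + r).
  move=> r0 r1; rewrite /g; case: xgetP => [q _ //|].
  have [||q hq /(_ q)//] := @on_edge_ex R G u v (s + r) uv; lra.
exists g; rewrite dxy; split.
- by apply: on_edge_inj xs; have := gP 0; rewrite addr0; apply; lra.
- by apply: on_edge_inj yt; have := gP (t - s); rewrite (_ : s + (t - s) = t); [apply; lra | ring].
- move=> r r'; rewrite !in_itv/= => /andP[r0 r1] /andP[r'0 r'1].
  rewrite (mdist_same_edge (gP _ r0 r1) (gP _ r'0 r'1)); congr `|_|; ring.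
- apply/seteqP; split=> [q [r /andP[r0 r1] hq]|_ [r /= + <-]].
    exists (r - s); first by rewrite /= in_itv/=; lra.
    apply: on_edge_inj hq; have := gP (r - s); rewrite (_ : s + (r - s) = r); [apply; lra | ring].
  by rewrite in_itv/= => /andP[r0 r1]; exists (s + r); [lra | exact: gP].
Qed.

Lemma edge_segment_mdist_ge p u v s t r q : edge_segment u v s t q ->
  (forall k, s <= k <= t -> r <= d p (V u) + k) ->
  (forall k, s <= k <= t -> r <= d p (V v) + (1 - k)) ->
  (forall k l, s <= k <= t -> on_edge p u v l -> r <= `|l - k|) -> r <= d p q.
Proof.
move=> [k kst qk] h1 h2 h3; apply: mdist_ge_edge qk _ _ _; [exact: h1|exact: h2|].
by move=> l; exact: h3.
Qed.

Lemma geodesic_vertex_at x y A u n : geodesic_segment x y A -> A (V u) ->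
  d x (V u) + n%:R <= d x y ->
  exists w, [/\ A (V w), d x (V w) = d x (V u) + n%:R & d (V u) (V w) = n%:R].
Proof.
move=> hA Au hn; have [g [g0 g1 gi gA gE]] := geodesic_param hA.
have d0 := mdist_ge0 x (V u); have n0 : 0 <= n%:R :> R by [].
have dq : d (V u) (g (d x (V u) + n%:R)) = n%:R.
  by rewrite -{1}(gE _ Au) gi ?opprD ?addrA ?subrr ?sub0r ?normrN ?ger0_norm//; lra.
have [w hw] := vertex_of_mdist_nat dq; exists w; rewrite -hw; split=> //.
  by apply: gA; lra.
by rewrite -{1}g0 gi ?sub0r ?normrN ?ger0_norm//; lra.
Qed.

Lemma adj_of_mdist1 u v : d (V u) (V v) = 1 -> adj u v.
Proof.
move=> h; have [|uv|//] := @mdist_vertex_lt2 R G u v; first by rewrite h; lra.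
by rewrite uv mdistxx in h; have := @ltr01 R; rewrite -h ltxx.
Qed.

Lemma geodesic_next x y A u : geodesic_segment x y A -> A (V u) ->
  d x (V u) + 1 <= d x y ->
  exists w, [/\ A (V w), d x (V w) = d x (V u) + 1 & adj u w].
Proof.
move=> hA Au h; have [//|w [Aw dw uw]] := geodesic_vertex_at (n := 1) hA Au.
by exists w; split=> //; exact: adj_of_mdist1.
Qed.

(** A geodesic cannot turn around inside an edge, so its first direction decides through which end
    it leaves. *)
Lemma geodesic_exit x y A u v s : geodesic_segment x y A -> on_edge x u v s ->
  0 < s < 1 ->
  [\/ exists t, on_edge y u v t, A (V u) /\ d x (V u) = s |
      A (V v) /\ d x (V v) = 1 - s].
Proof.
move=> hA xs /andP[s0 s1].
have [yuv|nyuv] := pselect (exists t, on_edge y u v t); first by constructor 1.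
(* By the symmetry exchanging [u] and [v], one point [q] of the geodesic that lies on the edge
   beyond [x] in the direction of [v] is enough. *)
suff key : forall u v s, on_edge x u v s -> 0 < s -> s < 1 ->
    ~ (exists t, on_edge y u v t) -> forall q e, A q -> 0 < e ->
    d x q = e -> on_edge q u v (s + e) -> e < 1 - s ->
    A (V v) /\ d x (V v) = 1 - s.
  have [g [g0 g1 gi gA gE]] := geodesic_param hA.
  (* The point at distance [m / 2] from [x] is too close to have passed an end of the edge. *)
  pose m := Num.min s (1 - s).
  have m0 : 0 < m by rewrite lt_min s0 subr_gt0.
  have ms : m <= s by rewrite ge_min lexx.
  have ms' : m <= 1 - s by rewrite ge_min lexx orbT.
  have mL : m <= d x y.
    rewrite metric_sym; have h1 := mdist_ge0 y (V u); have h2 := mdist_ge0 y (V v).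
    by have [->|->|[t yt]] := mdist_edge y xs; [lra | lra | case: nyuv; exists t].
  have Aq : A (g (m / 2)) by apply: gA; lra.
  have dq : d x (g (m / 2)) = m / 2.
    by rewrite -{1}g0 gi ?sub0r ?normrN ?ger0_norm//; lra.
  have h1 := mdist_ge0 (g (m / 2)) (V u); have h2 := mdist_ge0 (g (m / 2)) (V v).
  have := mdist_edge (g (m / 2)) xs; rewrite (metric_sym _ x) dq => -[h|h|[t qt h]]; try lra.
  have [st|st] := leP s t.
    constructor 3; apply: (key _ _ _ xs) Aq _ dq _ _ => //; try lra.
    rewrite ger0_norm in h; last by rewrite subr_ge0.
    by have -> : s + m / 2 = t by lra.
  constructor 2; rewrite -[X in _ = X](subKr 1).
  apply: (key _ _ _ (on_edge_sym xs)) Aq _ dq _ _; try lra.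
    by move=> [r /on_edge_sym yr]; apply: nyuv; exists (1 - r).
  rewrite ltr0_norm in h; last by lra.
  have -> : 1 - s + m / 2 = 1 - t by lra.
  exact: on_edge_sym.
move=> {nyuv s0 s1 xs} {}u {}v {}s xs s0 s1 ny q e Aq e0 dq qs es.
have [g [g0 g1 gi gA gE]] := geodesic_param hA.
have hb := geodesic_between hA Aq.
have ny' r : on_edge y u v r -> False by move=> yr; apply: ny; exists r.
(* From [q], the end [y] is reached through [v]: going back through [u] would pass [x] again. *)
have hL : d x y = d y (V v) + (1 - s).
  move: hb; rewrite dq (metric_sym q) (metric_sym x) => hb.
  have := mdist_le_left y xs.
  by have [h|h|[r /ny' []]] := mdist_edge y qs; lra.
have L1 : 1 - s <= d x y by rewrite hL lerDr mdist_ge0.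
have Aw : A (g (1 - s)) by apply: gA; lra.
have dw : d x (g (1 - s)) = 1 - s.
  by rewrite -{1}g0 gi ?sub0r ?normrN ?ger0_norm//; lra.
have dqw : d q (g (1 - s)) = 1 - s - e.
  by rewrite -(gE _ Aq) dq gi ?[`|_ - _|]ler0_norm; lra.
suff wv : g (1 - s) = V v by rewrite -wv.
have h0 := mdist_le_left (g (1 - s)) xs.
have h1 := mdist_ge0 (g (1 - s)) (V v).
have := mdist_edge (g (1 - s)) qs; rewrite (metric_sym _ q) dqw => -[h|h|[r wr h]].
- by exfalso; move: h0; rewrite (metric_sym _ x) dw; lra.
- by apply: mdist_positivity; lra.
- have := mdist_same_edge wr xs; rewrite (metric_sym _ x) dw => h'.
  suff r1 : r = 1 by rewrite r1 in wr; exact: on_edge1 wr.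
  have r1 := on_edge_le1 wr.
  have [rs|rs] := leP s r; first by rewrite ger0_norm in h'; lra.
  by rewrite (ltr0_norm (x := r - s)) in h'; [rewrite ltr0_norm in h; lra | lra].
Qed.

(** Both ends are too far to lie on the edge of [p], so the two halves of the geodesic leave this
    edge through different ends, one of which is within 1/2. *)
Lemma geodesic_near_vertex x y A p : geodesic_segment x y A -> A p ->
  1 < d x p -> 1 < d p y -> exists2 v, A (V v) & d p (V v) <= 1 / 2.
Proof.
move=> hA Ap xp py; have [[v pv]|[u [v [s [uv s01 pE]]]]] := coordP p.
  exists v; first by have <- : p = V v by exact: coord_inj.
  by have <- : p = V v by [exact: coord_inj]; rewrite mdistxx; lra.
have ps : on_edge p u v s by [].
have [s0|s0] := eqVneq s 0.
  by exists u; rewrite s0 in ps; rewrite -(on_edge0 ps)// mdistxx; lra.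
have [s1|s1] := eqVneq s 1.
  by exists v; rewrite s1 in ps; rewrite -(on_edge1 ps)// mdistxx; lra.
have {s0 s1}s01' : 0 < s < 1.
  by rewrite !lt_neqAle eq_sym s0 s1.
have [B hB BA] := geodesic_sub hA Ap.
have [C hC CA] := geodesic_sub (geodesic_sym hA) Ap.
have hxy := geodesic_between hA Ap.
have far z : 1 < d p z -> ~ exists t, on_edge z u v t.
  move=> pz [t zt]; move: pz; rewrite (mdist_same_edge ps zt) ltNge; apply/negP/negPn.
  by have := on_edge_ge0 zt; have := on_edge_le1 zt; rewrite ler_norml; lra.
have := geodesic_exit hB ps s01'; have := geodesic_exit hC ps s01'.
case=> [|[Cu du]|[Cv dv]]; first by move=> h; case: (far x) => //; rewrite metric_sym.
  case=> [/far//|[Bu _]|[Bv dv]].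
    have := geodesic_between hB Bu; have := geodesic_between hC Cu.
    have := metric_triangle x (V u) y.
    by rewrite [d p x]metric_sym [d (V u) x]metric_sym; lra.
  have [h|h] := leP s (1 / 2); first by exists u; [exact: (CA _ Cu).1 | lra].
  by exists v; [exact: (BA _ Bv).1 | lra].
case=> [/far//|[Bu du]|[Bv _]].
  have [h|h] := leP s (1 / 2); first by exists u; [exact: (BA _ Bu).1 | lra].
  by exists v; [exact: (CA _ Cv).1 | lra].
have := geodesic_between hB Bv; have := geodesic_between hC Cv.
have := metric_triangle x (V v) y.
by rewrite [d p x]metric_sym [d (V v) x]metric_sym; lra.
Qed.

End GeodesicsInGraphs.

(** * Invariance under graph isomorphism *)

Section IsomorphismInvariance.
Variables (R : realType) (G H : graph) (f : G -> H) (g : H -> G).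
Hypotheses (fK : cancel f g) (gK : cancel g f).
Hypothesis f_adj : forall x y, adj x y <-> adj (f x) (f y).

Lemma edge_coord_transport (u v : G) (t : R) :
  edge_coord u v t \o g = edge_coord (f u) (f v) t.
Proof.
have gE w a : (g w = a) = (w = f a) by apply/propext; split=> [<-|->].
by apply/funext => w; rewrite /edge_coord /vertex_coord /= !gE.
Qed.

Lemma transport_exists (x : realization R G) :
  exists y : realization R H, Defs.coord y = Defs.coord x \o g.
Proof.
have [[v xE]|[u [v [t [uv t01 xE]]]]] := coordP x.
  exists (vertex_point R (f v)); rewrite xE; apply/funext => w.
  by rewrite /= /vertex_coord; congr (nat_of_bool _)%:R; apply/asbool_equiv_eq;
    split=> [->|<-].
have /andP[t0 t1] := t01; have [y [_ _ yE]] := on_edge_ex ((f_adj u v).1 uv) t0 t1.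
by exists y; rewrite yE xE edge_coord_transport.
Qed.

Definition transport x := sval (cid (transport_exists x)).

Lemma transport_coord x : Defs.coord (transport x) = Defs.coord x \o g.
Proof. by rewrite /transport; case: cid. Qed.

Lemma transport_route x y l : route x y l -> route (transport x) (transport y) l.
Proof.
elim=> [z|u v s t a b c k uv s01 t01 aE bE _ IH]; first exact: route_nil.
apply: route_step ((f_adj u v).1 uv) s01 t01 _ _ IH.
  by rewrite transport_coord aE edge_coord_transport.
by rewrite transport_coord bE edge_coord_transport.
Qed.

Lemma mdist_transport_le x y : mdist (transport x) (transport y) <= mdist x y.
Proof.
by apply: graph_dist_ge => l /transport_route; exact: graph_dist_le.
Qed.

End IsomorphismInvariance.

Lemma isomorphic_sym (G H : simple_graph) : isomorphic G H -> isomorphic H G.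
Proof.
move=> [f [[g fK gK] h]]; exists g; split; first by exists f.
by move=> x y; rewrite h !gK.
Qed.

Lemma isomorphic_delta_le (R : realType) (G H : graph) : isomorphic G H ->
  (delta (realization R G) <= delta (realization R H))%E.
Proof.
move=> [f [[g fK gK] h]].
have h' x y : adj x y <-> adj (g x) (g y) by rewrite h !gK.
pose F := @transport R _ _ _ _ fK gK h; pose F' := @transport R _ _ _ _ gK fK h'.
have FK z : F' (F z) = z.
  by apply: coord_inj; rewrite !transport_coord; apply/funext => w /=; rewrite fK.
have isoF x y : mdist (F x) (F y) = mdist x y.
  apply/le_anti; rewrite mdist_transport_le//=.
  by rewrite -{1}(FK x) -{1}(FK y); exact: mdist_transport_le.
exact: (isometry_delta_le isoF).
Qed.

Lemma isomorphic_delta (R : realType) (G H : graph) : isomorphic G H ->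
  delta (realization R G) = delta (realization R H).
Proof.
move=> h; apply/le_anti; rewrite isomorphic_delta_le//=.
by apply: isomorphic_delta_le; exact: isomorphic_sym.
Qed.

(** * Trees *)

HB.instance Definition _ (G : simple_graph) := gen_eqMixin (vertex G).

Section Trees.
Variable G : graph.
Implicit Types m u v w : G.

(* Only the vertices after the start [u] are required to differ from [m]. *)
Definition avoids m u v : Prop := exists p : seq G,
  path (fun a b : G => `[< @adj G a b /\ b <> m >]) u p /\ last u p = v.

Lemma avoids_refl m u : avoids m u u.
Proof. by exists [::]. Qed.

Lemma avoids_step m u v w : avoids m u v -> adj v w -> w <> m -> avoids m u w.
Proof.
move=> [p [hp <-]] vw wm; exists (rcons p w); rewrite rcons_path last_rcons hp.
by split=> //; apply/asboolP.
Qed.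

Lemma avoids_neq m u v : avoids m u v -> u <> m -> v <> m.
Proof.
move=> [p [+ <-]]; elim: p u => //= a p IH u /andP[/asboolP[_ am] hp] _.
exact: IH.
Qed.

Hypothesis treeG : tree G.

(** Otherwise a repetition-free path from [u] to [w] avoiding [m] closes up through [m] to a
    cycle. *)
Lemma tree_neighbor_unique m u w : adj m u -> adj m w -> avoids m u w -> u = w.
Proof.
move=> mu mw [p [hp lp]]; apply: contrapT => uw.
case: (shortenP hp) lp => q hq uq _ lq.
have q0 : (0 < size q)%N by case: (q) lq => //=.
have mq : m \notin u :: q.
  have hm a (s : seq G) :
      path (fun a b : G => `[< @adj G a b /\ b <> m >]) a s -> m \notin s.
    elim: s a => [|b s IH a]; first by []. move=> /andP[/asboolP[_ bm] /IH hs].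
    by rewrite in_cons negb_or hs andbT; apply/eqP => mb; apply: bm.
  rewrite in_cons negb_or (hm _ _ hq) andbT; apply/eqP => mE.
  by move: mu; rewrite mE; exact: adj_irrefl.
pose s : seq G := m :: u :: q.
pose n := size s; pose c (i : 'I_n) : G := nth m s i.
have us : uniq s by rewrite cons_uniq mq.
have hpath : path (fun a b : G => `[< @adj G a b >]) m (u :: q).
  rewrite /=; apply/andP; split; first exact/asboolP.
  by apply: sub_path hq => a b /asboolP[ab _]; exact/asboolP.
have cS (i : 'I_n) : adj (c i) (c (ordS i)).
  rewrite /c /=; have [ltin|] := ltnP i.+1 n.
    rewrite modn_small//; have /(pathP m) := hpath.
    by move=> /(_ i ltin)/asboolP.
  move=> lein; have iE : i.+1 = n by apply/eqP; rewrite eqn_leq lein ltn_ord.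
  rewrite iE modnn /=; have -> : nat_of_ord i = (size s).-1 by have := congr1 predn iE.
  by rewrite nth_last /= lq; exact: adj_sym.
apply: (@treeG n c) => [|i j /eqP|i j].
- by rewrite /n /s /= !ltnS.
- by rewrite (nth_uniq _ (ltn_ord i) (ltn_ord j) us) => /eqP /val_inj.
- by case/andP=> _ /or4P[/eqP->|/eqP->|//|//]; [|apply: adj_sym]; exact: cS.
Qed.

Lemma tree_no_triangle u v w : adj u v -> adj v w -> adj u w -> False.
Proof.
move=> uv vw uw; have wu : w <> u by exact/nesym/adj_neq.
have := tree_neighbor_unique uv uw (avoids_step (avoids_refl u v) vw wu).
by move=> vE; move: vw; rewrite vE; exact: adj_irrefl.
Qed.

(** The edge between [u] and [m] is the only way out of the component of [u] in the tree minus
    [m]. *)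
Lemma avoids_boundary m u v v' : adj m u -> adj v v' ->
  avoids m u v -> ~ avoids m u v' -> v = u /\ v' = m.
Proof.
move=> mu vv' av nav.
have v'm : v' = m by apply: contrapT => v'm; apply: nav; exact: avoids_step av vv' v'm.
split=> //; rewrite v'm in vv'; apply/esym.
exact: tree_neighbor_unique mu (adj_sym vv') av.
Qed.

End Trees.

Section TreeDelta.
Variables (R : realType) (G : graph).
Hypothesis treeG : tree G.
Local Notation V := (@vertex_point R G).
Local Notation d := (@mdist R (realization R G)).

(** An interior point of an edge cuts the tree in two. It separates [x] from [y], so the side
    joining [z] to the end across the cut passes through [p]. *)
Lemma tree_triangle_side x y z (A B C : set (realization R G)) p :
  geodesic_triangle x y z A B C -> A p -> (forall v, p <> V v) ->
  0 < d p x -> 0 < d p y -> B p \/ C p.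
Proof.
move=> [hA hB hC] Ap pv px py.
have [[v pE]|[a [b [s [ab s01 pE]]]]] := coordP p.
  by case: (pv v); exact: coord_inj.
have ps : on_edge p a b s by [].
have s0 : s != 0 by apply/eqP => sE; move: ps; rewrite sE => /on_edge0; exact: pv.
have s1 : s != 1 by apply/eqP => sE; move: ps; rewrite sE => /on_edge1; exact: pv.
have {s0 s1}s01 : 0 < s < 1.
  by case/andP: s01 => s00 s11; rewrite !lt_neqAle s00 s11 s1 eq_sym s0.
pose phi w : R := `[< avoids a b w >]%:R.
pose h := pl_extension phi.
have phi01 w : phi w = 0 \/ phi w = 1 by rewrite /phi; case: asboolP; [right|left].
have hl q q' : `|h q - h q'| <= d q q'.
  apply: pl_extension_lipschitz => u v _; rewrite ler_norml.
  by case: (phi01 u) => ->; case: (phi01 v) => ->; lra.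
have phia : phi a = 0.
  by rewrite /phi asboolF// => /avoids_neq; apply=> //; exact/nesym/adj_neq.
have phib : phi b = 1 by rewrite /phi asboolT//; exact: avoids_refl.
have hE q t : on_edge q a b t -> h q = t.
  by move=> qt; rewrite /h (pl_extension_edge _ qt) phia phib; ring.
(* [phi] takes only the values 0 and 1 and changes on no edge but the one of [p], so a value
   strictly between them pins down the point. *)
have hs q : h q = s -> q = p.
  have [[v qE]|[v [v' [t [vv' t01 qE]]]]] := coordP q.
    have -> : q = V v by exact: coord_inj.
    by rewrite /h pl_extension_vertex; case: (phi01 v) => -> sE; exfalso; lra.
  have qt : on_edge q v v' t by [].
  rewrite /h (pl_extension_edge _ qt).
  have bnd w w' : adj w w' -> phi w = 1 -> phi w' = 0 -> w = b /\ w' = a.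
    rewrite /phi => ww'; case: asboolP => [aw _|_ /eqP]; last by rewrite eq_sym oner_eq0.
    case: asboolP => [_ /eqP|naw _]; first by rewrite oner_eq0.
    exact: avoids_boundary (ab) ww' aw naw.
  case: (phi01 v) => e; case: (phi01 v') => e'; rewrite e e' => hE'.
  - exfalso; lra.
  - have [v'b va] := bnd _ _ (adj_sym vv') e' e; subst v v'.
    have ts : t = s by lra.
    by rewrite ts in qt; exact: on_edge_inj qt ps.
  - have [v'b va] := bnd _ _ vv' e e'; subst v v'.
    have ts : 1 - t = s by lra.
    by move/on_edge_sym: qt; rewrite ts => qs; exact: on_edge_inj qs ps.
  - exfalso; lra.
have neq0 q : 0 < d p q -> p <> q by move=> + pq; rewrite pq mdistxx ltxx.
(* A geodesic leaving [p] never returns to it, so [h] stays on one side of [s]: the first step [q]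
   already decides the side of [w]. *)
have side w D : geodesic_segment p w D -> 0 < d p w ->
    exists q t, [/\ D q, on_edge q a b t & (t < s) && (h w < s) || (s < t) && (s < h w)].
  move=> hD pw.
  have [q [t [Dq qt ts]]] : exists q t, [/\ D q, on_edge q a b t & t != s].
    have [[t wt]|[Da _]|[Db _]] := geodesic_exit hD ps s01.
    - exists w, t; split=> //; first exact: geodesic_right hD.
      apply/eqP => tE; apply: (neq0 _ pw); rewrite tE in wt; exact: on_edge_inj ps wt.
    - by exists (V a), 0; split=> //; [exact: on_edge_left | lra].
    - by exists (V b), 1; split=> //; [exact: on_edge_right | lra].
  exists q, t; split=> //; have [E hE' ED] := geodesic_sub hD Dq.
  have nEp : ~ E p.
    move=> /ED[_]; rewrite mdistxx (mdist_same_edge ps qt) leNgt => /negP; apply.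
    by rewrite normr_gt0 subr_eq0 eq_sym.
  have hw : h w <> s by move/hs => wp; exact: (neq0 _ pw).
  have hqE := hE _ _ qt.
  move: ts; rewrite neq_lt => /orP[ts|ts]; rewrite ts /= ?orbF.
    rewrite (lt_gtF ts) orbF ltNge; apply/negP => hle; apply: nEp.
    have [|q' Eq' /hs <-//] := @geodesic_IVT _ _ h _ _ _ s hE' hl.
    by rewrite hqE hle ltW.
  rewrite (lt_gtF ts) /= ltNge; apply/negP => hle; apply: nEp.
  have [|q' Eq' /hs <-//] := @geodesic_IVT _ _ h _ _ _ s (geodesic_sym hE') hl.
  by rewrite hqE hle ltW.
have [A1 hA1 A1A] := geodesic_sub hA Ap.
have [A2 hA2 A2A] := geodesic_sub (geodesic_sym hA) Ap.
have [q1 [t1 [Aq1 qt1 h1]]] := side _ _ hA1 py.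
have [q2 [t2 [Aq2 qt2 h2]]] := side _ _ hA2 px.
(* [p] lies between [q2] and [q1], so the two halves of [A] start in opposite directions on the
   edge. *)
have dd : d q2 p + d p q1 <= d q2 q1.
  have := geodesic_between hA1 Aq1; have := geodesic_between hA2 Aq2.
  have := geodesic_between hA Ap; have := metric_triangle x q2 y.
  have := metric_triangle q2 q1 y.
  by rewrite (metric_sym p q2) (metric_sym q2 x) (metric_sym p x); lra.
have opp : (h x < s) && (s < h y) || (h y < s) && (s < h x).
  move: dd; rewrite (mdist_same_edge qt2 ps) (mdist_same_edge ps qt1) (mdist_same_edge qt2 qt1).
  move: h1 h2 => /orP[]/andP[t1s hy] /orP[]/andP[t2s hx]; rewrite ?hx ?hy ?orbT// leNgt;
    move=> /negP; case.
    rewrite (ltr0_norm (x := t2 - s)) ?subr_lt0// (gtr0_norm (x := s - t1)) ?subr_gt0//.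
    by rewrite ltr_norml; lra.
  rewrite (gtr0_norm (x := t2 - s)) ?subr_gt0// (ltr0_norm (x := s - t1)) ?subr_lt0//.
  by rewrite ltr_norml; lra.
have ivt u w D : geodesic_segment u w D -> h u <= s <= h w \/ h w <= s <= h u -> D p.
  move=> hD [|] hh.
    by have [q Dq /hs <-] := geodesic_IVT hD hl hh.
  by have [q Dq /hs <-] := geodesic_IVT (geodesic_sym hD) hl hh.
have [hz|hz] := leP (h z) s; case/orP: opp => /andP[h3 h4].
- by left; apply: ivt hB _; right; rewrite hz ltW.
- by right; apply: ivt hC _; left; rewrite hz ltW.
- by right; apply: ivt hC _; right; rewrite !ltW.
- by left; apply: ivt hB _; left; rewrite !ltW.
Qed.

End TreeDelta.

(** The separation argument excludes vertices. Two points of a geodesic at positive distance less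
    than 1 are not both vertices, so each point of a side is approximated by points where it
    applies. *)
Lemma tree_delta (R : realType) (G : graph) : tree G -> delta (realization R G) = 0%E.
Proof.
move=> treeG; have [o _] := graph_nonempty G.
apply/le_anti; rewrite (delta_ge0 (vertex_point R o)) andbT.
apply: delta_le => // x y z A B C p T Ap; have [hA hB hC] := T.
have dxp := mdist_ge0 x p; have dpy := mdist_ge0 p y.
have hxy := geodesic_between hA Ap.
have [L0|L0] := leP (mdist x y) 0.
  apply: (@dist_set_le _ _ _ _ x); first by right; exact: geodesic_right hC.
  by rewrite metric_sym; lra.
apply: dist_set_approx => e e0; rewrite add0r.
have [g [g0 g1 gi gA gE]] := geodesic_param hA.
(* Two steps of length [k] from [p] towards the farther end stay inside the side, within [e] of [p],
   and less than 1 apart. *)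
pose k := Num.min e (Num.min (mdist x y) 1) / 8.
have ke : k <= e / 8 by rewrite ler_pM2r// ge_min lexx.
have kL : k <= mdist x y / 8 by rewrite ler_pM2r// !ge_min lexx orbT.
have k1 : k <= 1 / 8 by rewrite ler_pM2r// !ge_min lexx !orbT.
have k0 : 0 < k by rewrite divr_gt0// !lt_min e0 L0 ltr01.
have near t : 0 < t -> t < mdist x y -> `|mdist x p - t| <= e ->
    (forall v, g t <> vertex_point R v) -> exists2 q, (B `|` C) q & mdist p q <= e.
  move=> t0 tL te nv.
  have dxt : mdist x (g t) = t.
    by rewrite -{1}g0 gi ?sub0r ?normrN ?ger0_norm// ?ltW.
  have Agt : A (g t) by apply: gA; exact: ltW.
  exists (g t); last by rewrite -(gE _ Ap) gi ?(ltW t0) ?(ltW tL)//; lra.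
  apply: (tree_triangle_side treeG T Agt) => //; first by rewrite metric_sym dxt.
  by have := geodesic_between hA Agt; lra.
have two s t : 0 < s -> s < mdist x y -> `|mdist x p - s| <= e ->
    0 < t -> t < mdist x y -> `|mdist x p - t| <= e -> 0 < t - s -> t - s < 1 ->
    exists2 q, (B `|` C) q & mdist p q <= e.
  move=> s0 sL se t0 tL te st0 st1.
  have [[v gs]|ns] := pselect (exists v, g s = vertex_point R v); last first.
    by apply: (near s) => // w gs; apply: ns; exists w.
  have [[w gt]|nt] := pselect (exists w, g t = vertex_point R w); last first.
    by apply: (near t) => // w gt; apply: nt; exists w.
  have : mdist (g t) (g s) = t - s.
    by rewrite gi ?ltW// ger0_norm// ltW.
  rewrite gs gt mdist_vertex => dE; move: st0 st1; rewrite -dE.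
  by case: (vdist _ _) => [|m]; rewrite ?ltxx// ltrn1.
move: two; move: {near gE gA gi g0 g1 g} (mdist x p) (mdist p y) (mdist x y) k
  dxp dpy hxy L0 ke kL k1 k0 => a b L k a0 b0 abL L0 ke kL k1 k0 two.
have [h|h] := leP a (L / 2).
  by apply: (two (a + k) (a + 2 * k)); rewrite ?ler_norml; lra.
by apply: (two (a - 2 * k) (a - k)); rewrite ?ler_norml; lra.
Qed.

(** * Distances in lexicographic products *)

Section LexProductFacts.
Variables (R : realType) (G1 G2 : graph).
Local Notation G := (lexprod G1 G2).
Local Notation V := (@vertex_point R G).
Local Notation d := (@mdist R (realization R G)).
Implicit Types (v w : G) (x y p q : realization R G).

Lemma lexprod_trivial_left : isomorphic G1 E1 -> isomorphic G G2.
Proof.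
move=> [f [[g fK gK] h]].
have triv (a b : G1) : a = b by rewrite -(fK a) -(fK b); case: (f a) (f b) => -[].
have [o _] := graph_nonempty G1.
exists snd; split; last first.
  move=> [a i] [b j]; rewrite /= /lex_adj /=; split; last by right; split.
  by case=> [|[]//]; rewrite (triv a b) => /adj_irrefl.
by exists (fun i => (o, i) : G) => [[a i]|] //=; rewrite (triv o a).
Qed.

Lemma lexprod_trivial_right : isomorphic G2 E1 -> isomorphic G G1.
Proof.
move=> [f [[g fK gK] h]].
have triv (a b : G2) : a = b by rewrite -(fK a) -(fK b); case: (f a) (f b) => -[].
have [o _] := graph_nonempty G2.
exists fst; split; last first.
  move=> [a i] [b j]; rewrite /= /lex_adj /=; split; last by left.
  by case=> [//|[_]]; rewrite (triv i j) => /adj_irrefl.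
by exists (fun a => (a, o) : G) => [[a i]|] //=; rewrite (triv o i).
Qed.

Lemma lex_adj_layers v w : adj v.1 w.1 -> adj v w.
Proof. by left. Qed.

Lemma lex_adj_cases v w : adj v w -> v.1 = w.1 /\ adj v.2 w.2 \/ adj v.1 w.1.
Proof. by case; [right|left]. Qed.

(* Any two vertices of a layer have a common neighbour in an adjacent layer. *)
Lemma mdist_layer_le2 v w : (exists a b : G1, adj a b) -> v.1 = w.1 -> d (V v) (V w) <= 2.
Proof.
move=> [a [b ab]] vw.
have [u vu] : exists u, adj v.1 u.
  have [->|va] := pselect (v.1 = a); first by exists b.
  have := vdist_walk v.1 a; case E : (vdist v.1 a) => [|n]; first by have := vdist_eq0 E.
  by have [c vc _] := vdistS E; exists c.
have h1 : @adj G v (u, v.2) by left.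
have h2 : @adj G (u, v.2) w by left; rewrite /= -vw; exact: adj_sym.
exact: mdist_vertex_le2 h1 h2.
Qed.

(** The step of a walk that first enters the layer of [w] comes from an adjacent layer, hence can be
    redirected to any vertex of that layer. *)
Lemma mdist_other_layer v w w' : v.1 <> w.1 -> w.1 = w'.1 ->
  d (V v) (V w') <= d (V v) (V w).
Proof.
move=> vw ww'; rewrite !mdist_vertex ler_nat.
suff [m hm mn] : exists2 m, walk v w' m & (m <= vdist v w)%N.
  exact: leq_trans (vdist_le hm) mn.
elim: (vdist_walk v w) vw ww' => [u|a b c n ab _ IH] // ac cw'.
have [bc|bc] := pselect (b.1 = c.1); last first.
  by have [m hm mn] := IH bc cw'; exists m.+1; [exact: walk_cons ab hm|].
exists 1 => //; apply: walk1; case: (lex_adj_cases ab) => [[ab1 _]|ab1].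
  by case: ac; rewrite ab1.
by left; rewrite -cw' -bc.
Qed.

End LexProductFacts.

(** * The upper bound 3/2 *)

Section UpperBoundOverTrees.
Variables (R : realType) (G1 G2 : graph).
Local Notation G := (lexprod G1 G2).
Local Notation V := (@vertex_point R G).
Local Notation d := (@mdist R (realization R G)).
Implicit Types (u v w : G) (x y p q : realization R G).
Hypothesis edge1 : exists a b : G1, adj a b.

Lemma lexprod_edge : exists v w : G, adj v w.
Proof.
have [a [b ab]] := edge1; have [o _] := graph_nonempty G2.
by exists (a, o), (b, o); left.
Qed.

(** From outside their layer, [u] and [w] look equally far. The gap 2 forces [u] to be an end of the
    edge of [x], and a second end in another layer would be adjacent to [w] and give a shorter
    way. *)
Lemma edge_in_layer u w x : u.1 = w.1 -> 0 < d (V u) x ->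
  d (V w) x = d (V u) x + 2 ->
  exists e e' r, [/\ on_edge x e e' r, e.1 = u.1 & e'.1 = u.1].
Proof.
move=> uw ux wx.
have [e [e' [r [xr uxr]]]] : exists e e' r, on_edge x e e' r /\ d (V u) x = d (V u) (V e) + r.
  have [v [v' vv']] := lexprod_edge; have [e [e' [r xr]]] := on_some_edge x vv'.
  have [h|h] := mdist_vertex_edge u xr; first by exists e, e', r.
  by exists e', e, (1 - r); split=> //; exact: on_edge_sym.
have eu : e.1 = u.1.
  apply: contrapT => eu; have := mdist_other_layer R eu uw.
  have := mdist_le_left (V w) xr.
  by rewrite (metric_sym (V w) (V e)) (metric_sym (V u) (V e)) in uxr *; lra.
have ew : d (V w) (V e) <= 2 by apply: mdist_layer_le2; rewrite // eu.
have uE : u = e.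
  apply: vertex_point_inj; apply: (@mdist_positivity R); apply/le_anti.
  by rewrite mdist_ge0 andbT; have := mdist_le_left (V w) xr; lra.
exists e, e', r; split=> //; apply: contrapT => e'u; subst e.
have [ee' _ _] := xr.
have ae : adj e'.1 w.1.
  case: (lex_adj_cases (adj_sym ee')) => [[//]|]; by rewrite uw.
have := mdist_le_right (V w) xr; rewrite (mdist_adj R (adj_sym (lex_adj_layers ae))).
by move: uxr; rewrite mdistxx; lra.
Qed.

(** The nearest ends of the two edges are within 1/2 of the points and within 2 of each other. *)
Lemma mdist_same_layer_edges x y e e' f f' r s :
  on_edge x e e' r -> on_edge y f f' s ->
  e'.1 = e.1 -> f.1 = e.1 -> f'.1 = e.1 -> d x y <= 3.
Proof.
move=> xr ys h1 h2 h3.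
have key a b t u : on_edge x a b t -> a.1 = e.1 -> u.1 = e.1 -> d (V u) x <= 2 + t.
  move=> xt ae ue; have := mdist_le_left (V u) xt.
  have : d (V u) (V a) <= 2 by apply: mdist_layer_le2; rewrite // ae.
  lra.
have key2 u : u.1 = e.1 -> d x (V u) <= 5 / 2.
  move=> ue; rewrite metric_sym; have [hr|hr] := leP r (1 / 2).
    by have := key _ _ _ _ xr erefl ue; lra.
  by have := key _ _ _ _ (on_edge_sym xr) h1 ue; lra.
have [hs|hs] := leP s (1 / 2).
  by have := mdist_le_left x ys; have := key2 _ h2; lra.
by have := mdist_le_right x ys; have := key2 _ h3; lra.
Qed.

Hypothesis treeG1 : tree G1.

Lemma lexprod_tree_delta_le : (delta (realization R G) <= (3 / 2)%:E)%E.
Proof.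
apply: delta_le => [|x y z A B C p [hA hB hC] Ap]; first by lra.
apply: contrapT => /dist_set_far[e0 e00 far].
have px : 3 / 2 + e0 < d p x by apply: far; right; exact: geodesic_right hC.
have py : 3 / 2 + e0 < d p y by apply: far; left; exact: geodesic_left hB.
have bp := geodesic_between hA Ap.
rewrite (metric_sym p x) in px.
have [||M AM pM] := geodesic_near_vertex hA Ap; try lra.
have bM := geodesic_between hA AM.
have t1 := metric_triangle x (V M) p; have t2 := metric_triangle p (V M) y.
rewrite (metric_sym (V M) p) in t1.
have [|W [AW xW MW]] := geodesic_next hA AM; first by lra.
have [|U [AU yU MU]] := geodesic_next (geodesic_sym hA) AM.
  by rewrite (metric_sym y x) (metric_sym y (V M)); lra.
have bU := geodesic_between hA AU; have bW := geodesic_between hA AW.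
rewrite (metric_sym y (V U)) (metric_sym y (V M)) in yU.
have xWU : d x (V W) = d x (V U) + 2 by lra.
have yUW : d (V U) y = d (V W) y + 2 by lra.
have UW2 : 2 <= d (V U) (V W) by have := metric_triangle x (V U) (V W); lra.
(* If the layers agree, both ends of the side lie on edges of that layer and are within 3, although
   [p] is more than 3/2 from each. *)
have [UW|UW] := eqVneq U.1 W.1.
  have [||e [e' [r [xr eu e'u]]]] := @edge_in_layer U W x UW.
  - have := metric_triangle p (V M) (V U); have := metric_triangle p (V U) x.
    by rewrite (mdist_adj R MU) (metric_sym p x); lra.
  - by rewrite (metric_sym _ x) xWU (metric_sym x).
  have [||f [f' [s [ys fu f'u]]]] := @edge_in_layer W U y (esym UW).
  - have := metric_triangle p (V M) (V W); have := metric_triangle p (V W) y.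
    by rewrite (mdist_adj R MW); lra.
  - by rewrite yUW.
  have := @mdist_same_layer_edges _ _ _ _ _ _ _ _ xr ys.
  by rewrite e'u eu fu f'u UW => /(_ erefl erefl erefl); lra.
have nUW : @adj G U W -> false by move=> /(mdist_adj R) h; exfalso; lra.
(* If [U] lay in the layer of [M], then [W] would lie there too, which is excluded, or be adjacent
   to [U]. *)
have mu : adj M.1 U.1.
  case: (lex_adj_cases MU) => [[MU1 _]|//].
  case: (lex_adj_cases MW) => [[MW1 _]|MW1]; first by case/eqP: UW; rewrite -MU1 -MW1.
  have UW1 : @adj G U W by left; rewrite -MU1.
  by have := nUW UW1.
have mw : adj M.1 W.1.
  case: (lex_adj_cases MW) => [[MW1 _]|//].
  have UW1 : @adj G U W by left; rewrite -MW1; exact: adj_sym.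
  by have := nUW UW1.
pose phi v : R := `[< avoids M.1 U.1 v.1 >]%:R.
pose h := pl_extension phi.
have phi01 v : phi v = 0 \/ phi v = 1 by rewrite /phi; case: asboolP; [right|left].
have hl q q' : `|h q - h q'| <= d q q'.
  apply: pl_extension_lipschitz => u v _; rewrite ler_norml.
  clear -phi01; by case: (phi01 u) => ->; case: (phi01 v) => ->; lra.
have hU : h (V U) = 1.
  by rewrite /h pl_extension_vertex /phi asboolT//; exact: avoids_refl.
have hW : h (V W) = 0.
  rewrite /h pl_extension_vertex /phi asboolF// => /(tree_neighbor_unique treeG1 mu mw).
  exact/eqP.
have bnd v v' : @adj G v v' -> phi v = 1 -> phi v' = 0 -> v.1 = U.1 /\ v'.1 = M.1.
  rewrite /phi => vv'; case: asboolP => [av _|_ /eqP]; last by rewrite eq_sym oner_eq0.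
  case: asboolP => [_ /eqP|nav _]; first by rewrite oner_eq0.
  have vv1 : adj v.1 v'.1.
    by case: (lex_adj_cases vv') => [[vE _]|//]; case: nav; rewrite -vE.
  exact: (avoids_boundary treeG1 mu vv1 av nav).
have crossing q : 0 < h q -> h q < 1 ->
    exists v v', [/\ on_edge q v v' (1 - h q), v.1 = U.1 & v'.1 = M.1].
  have [[v qE]|[v [v' [t [vv' t01 qE]]]]] := coordP q.
    have -> : q = V v by exact: coord_inj.
    by rewrite /h pl_extension_vertex; case: (phi01 v) => ->; rewrite ltxx.
  have qt : on_edge q v v' t by [].
  have := pl_extension_edge phi qt; rewrite -/h => hq.
  case: (phi01 v) => e; case: (phi01 v') => e'; rewrite e e' in hq => h0 h1.
  - exfalso; lra.
  - have [v'U vM] := bnd _ _ (adj_sym vv') e' e; exists v', v; split=> //.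
    have -> : 1 - h q = 1 - t by lra.
    exact: on_edge_sym.
  - have [v'U vM] := bnd _ _ vv' e e'; exists v, v'; split=> //.
    by have -> : 1 - h q = t by lra.
  - exfalso; lra.
have h01 q : 0 <= h q <= 1.
  have [v [v' vv']] := lexprod_edge; have [e [e' [r xr]]] := on_some_edge q vv'.
  have := on_edge_ge0 xr; have := on_edge_le1 xr.
  by rewrite /h (pl_extension_edge _ xr); case: (phi01 e) => ->; case: (phi01 e') => ->; lra.
(* Where [h] is strictly between 0 and 1, a vertex of the layer of [M] is near,
   and it is adjacent to both [U] and [W]. *)
have close q w : 0 < h q -> h q < 1 -> adj M.1 w.1 -> d q (V w) < 2.
  move=> q0 q1 mw'; have [v [v' [qE _ v'M]]] := crossing q q0 q1.
  have vw : @adj G w v' by left; rewrite v'M; exact: adj_sym.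
  have := mdist_le_right (V w) qE; rewrite (mdist_adj R vw) metric_sym; lra.
(* If not, some point between [U] and [x] has a value strictly between 0 and 1 and is less than 2
   from [W]; but the geodesic still needs length 2 from [U] to [W]. The case of [y] is symmetric. *)
have hx : h x = 1.
  apply/le_anti; have /andP[x0 ->] := h01 x; rewrite leNgt; apply/negP => x1.
  have [D hD DA] := geodesic_sub (geodesic_sym hA) AU.
  have [|q Dq hq] := @geodesic_IVT _ _ h _ _ _ ((h x + 1) / 2) (geodesic_sym hD) hl.
    by rewrite hU; lra.
  have := geodesic_between hD Dq; have := metric_triangle x q (V W).
  have cq : d q (V W) < 2 by apply: close => //; rewrite hq; lra.
  have := mdist_ge0 (V U) q; rewrite (metric_sym (V U) x) (metric_sym q x); lra.
have hy : h y = 0.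
  apply/le_anti; have /andP[-> y1] := h01 y; rewrite andbT leNgt; apply/negP => y0.
  have [D hD DA] := geodesic_sub hA AW.
  have [|q Dq hq] := @geodesic_IVT _ _ h _ _ _ (h y / 2) hD hl.
    by rewrite hW; lra.
  have := geodesic_between hD Dq; have := metric_triangle (V U) q y.
  have cq : d q (V U) < 2 by apply: close => //; rewrite hq; lra.
  have := mdist_ge0 (V W) q; rewrite (metric_sym q (V U)) in cq; lra.
(* A point where [h] is [t] is within [e0] of a neighbour of [M], hence within $1/2+1+e_0$ of [p];
   the maximum keeps [t] positive. *)
pose t := Num.max (1 - e0) (1 / 2).
have te : 1 - e0 <= t by rewrite le_max lexx.
have t0 : 1 / 2 <= t by rewrite le_max lexx orbT.
have t1' : t < 1 by rewrite gt_max; lra.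
have [q Qq hq] : exists2 q, (B `|` C) q & h q = t.
  have [hz|hz] := leP (h z) t.
    have [|q Cq hq] := @geodesic_IVT _ _ h _ _ _ t hC hl; first by rewrite hx; lra.
    by exists q => //; right.
  have [|q Bq hq] := @geodesic_IVT _ _ h _ _ _ t hB hl; first by rewrite hy; lra.
  by exists q => //; left.
have [||v [v' [qE vU _]]] := crossing q; rewrite ?hq; try lra.
have vM : @adj G M v by left; rewrite vU.
have := far q Qq; have := mdist_le_left (V M) qE; have := metric_triangle p (V M) q.
by rewrite (mdist_adj R vM); lra.
Qed.

End UpperBoundOverTrees.

(** * Graphs of diameter at most 2 *)

Definition eq_or_adj (G : simple_graph) (u v : G) := u = v \/ adj u v.

Lemma eq_or_adj_sym (G : simple_graph) (u v : G) : eq_or_adj u v -> eq_or_adj v u.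
Proof. by case=> [->|/adj_sym]; [left|right]. Qed.

Section NearEdges.
Variables (R : realType) (G : graph).
Implicit Types (u v w a b : G) (p q x y z : realization R G) (r s t l : R).
Implicit Types A B : set (realization R G).
Local Notation V := (@vertex_point R G).
Local Notation d := (@mdist R (realization R G)).

(** Combinatorial form of diameter at most 2 when there is an edge. The diameter is taken over all
    points, so a vertex must also be within 2 of every midpoint. *)
Definition near_all_edges := forall w u v, adj u v -> eq_or_adj w u \/ eq_or_adj w v.

(** The routes through [a], [b] and through [a'], [b'] have total length at most 4. *)
Lemma matched_edges_mdist x y a a' b b' r s : on_edge x a a' r -> on_edge y b b' s ->
  eq_or_adj a b -> eq_or_adj a' b' -> d x y <= 2.
Proof.
move=> xr ys /(@mdist_vertex_le1 R) ab /(@mdist_vertex_le1 R) ab'.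
have h1 := mdist_le_left (V a) ys; have h2 := mdist_le_left y xr.
have h3 := mdist_le_right (V a') ys; have h4 := mdist_le_right y xr.
by move: h2 h4; rewrite !(metric_sym y); lra.
Qed.

(** Each end of either edge is close to some end of the other, which always leaves a perfect
    matching of close ends. *)
Lemma near_all_edges_mdist u v x y : adj u v -> near_all_edges -> d x y <= 2.
Proof.
move=> uv N; have [a [a' [r xr]]] := on_some_edge x uv.
have [b [b' [s ys]]] := on_some_edge y uv.
have [aa' _ _] := xr; have [bb' _ _] := ys.
have xr' := on_edge_sym xr; have ys' := on_edge_sym ys.
have [h1|h1] := N a b b' bb'; have [h2|h2] := N a' b b' bb'.
- have [h3|h3] := N b' a a' aa'.
    by apply: matched_edges_mdist xr' ys h2 _; exact: eq_or_adj_sym.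
  by apply: matched_edges_mdist xr ys h1 _; exact: eq_or_adj_sym.
- exact: matched_edges_mdist xr ys h1 h2.
- exact: matched_edges_mdist xr ys' h1 h2.
- have [h3|h3] := N b a a' aa'.
    by apply: matched_edges_mdist xr ys _ h2; exact: eq_or_adj_sym.
  by apply: matched_edges_mdist xr' ys _ h1; exact: eq_or_adj_sym.
Qed.

Lemma mdist_near_all_edges : (forall x y, d x y <= 2) -> near_all_edges.
Proof.
move=> d2 w u v uv; have [||m mE] := on_edge_ex (t := 1 / 2 : R) uv; try lra.
have := d2 (V w) m; have [->|->] := mdist_vertex_edge w mE => h.
  by left; apply: (@mdist_vertex_lt2 R); lra.
by right; apply: (@mdist_vertex_lt2 R); lra.
Qed.

End NearEdges.

Lemma near_all_edges_lexprod (G1 G2 : graph) : (forall u v : G1, eq_or_adj u v) ->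
  near_all_edges G2 -> near_all_edges (lexprod G1 G2).
Proof.
move=> h1 N w u v uv.
have [wu|] := h1 w.1 u.1; last by left; right; left.
have [wv|] := h1 w.1 v.1; last by right; right; left.
case: (lex_adj_cases uv) => [[_ uv2]|]; last by rewrite -wu wv => /adj_irrefl.
case: w u v uv wu wv uv2 => [w1 w2] [u1 u2] [v1 v2] /= _ wu wv uv2; subst.
have [[->|h]|[->|h]] := N w2 _ _ uv2.
- by left; left.
- by left; right; right.
- by right; left.
- by right; right; right.
Qed.

(** * Geodesics assembled from pieces of edges *)

Section Polylines.
Variables (R : realType) (G : graph).
Implicit Types (u v w a b : G) (p q x y z : realization R G) (r s t l : R).
Implicit Types A B : set (realization R G).
Local Notation V := (@vertex_point R G).
Local Notation d := (@mdist R (realization R G)).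

(** The index [l] is the total length. It lets a path be built piece by piece and recognized as a
    geodesic at the end by one inequality, [l <= d x y]. *)
Inductive polyline : realization R G -> realization R G -> R ->
    set (realization R G) -> Prop :=
| polyline_one x y A : geodesic_segment x y A -> polyline x y (d x y) A
| polyline_cons x y z l A B : geodesic_segment x y A -> polyline y z l B ->
    polyline x z (d x y + l) (A `|` B).

Lemma polyline_mdist x y l A : polyline x y l A -> d x y <= l.
Proof.
elim=> // {x y l A} x y z l A B _ _ IH.
by have := metric_triangle x y z; lra.
Qed.

Lemma polyline_geodesic x y l A : polyline x y l A -> l <= d x y -> geodesic_segment x y A.
Proof.
elim=> // {x y l A} x y z l A B hA hB IH hl.
have := metric_triangle x y z; have := polyline_mdist hB => h1 h2.
by apply: geodesic_cat hA (IH _) _; lra.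
Qed.

Lemma polyline_edge u v z l B : adj u v -> polyline (V v) z l B ->
  polyline (V u) z (1 + l) (edge_segment u v 0 1 `|` B).
Proof.
move=> uv hB; rewrite -(mdist_adj R uv); apply: polyline_cons hB.
rewrite (mdist_adj R uv).
exact: (edge_segment_geodesic (on_edge_left R uv) (on_edge_right R uv) ler01).
Qed.

Lemma mdist_left_eq z u v t : on_edge z u v t -> d (V u) z = t.
Proof.
move=> zt; have [uv /andP[t0 _] _] := zt.
by rewrite (mdist_same_edge (on_edge_left R uv) zt) sub0r normrN ger0_norm.
Qed.

Lemma edge_segment_from_left z u v t : on_edge z u v t ->
  geodesic_segment (V u) z (edge_segment u v 0 t).
Proof.
move=> zt; have [uv /andP[t0 _] _] := zt.
exact: edge_segment_geodesic (on_edge_left R uv) zt t0.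
Qed.

Lemma polyline_half x u v t z l B : on_edge x u v t -> polyline (V u) z l B ->
  polyline x z (t + l) (edge_segment u v 0 t `|` B).
Proof.
move=> xt hB; have := polyline_cons (geodesic_sym (edge_segment_from_left xt)) hB.
by rewrite metric_sym (mdist_left_eq xt).
Qed.

Lemma polyline_end z u v t : on_edge z u v t ->
  polyline (V u) z t (edge_segment u v 0 t).
Proof.
move=> zt; have := polyline_one (edge_segment_from_left zt).
by rewrite (mdist_left_eq zt).
Qed.

Lemma polyline_vertex u : polyline (V u) (V u) 0 [set V u].
Proof. by rewrite -(mdistxx (V u)); apply: polyline_one; exact: geodesic_refl. Qed.

(** On the edge itself the distances from [p] to its ends would add up to 1; the strict inequality
    keeps [p] off it, so only the ways through [u] and [v] remain. *)
Lemma edge_segment_far p u v s t r q : edge_segment u v s t q ->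
  1 < d p (V u) + d p (V v) -> r <= d p (V u) + s -> r <= d p (V v) + (1 - t) ->
  r <= d p q.
Proof.
move=> hq huv hu hv; apply: (edge_segment_mdist_ge hq) => [k|k|k l _ pl]; try lra.
have := mdist_left pl; have := mdist_right pl.
by rewrite !(metric_sym _ p); lra.
Qed.

Lemma mdist_edge_vertex_ge p u v s w k l : on_edge p u v s ->
  k <= d (V u) (V w) -> l <= d (V v) (V w) ->
  k + s <= d p (V w) \/ l + (1 - s) <= d p (V w).
Proof.
move=> ps; rewrite (metric_sym (V u)) (metric_sym (V v)) (metric_sym p).
by have [->|->] := mdist_vertex_edge w ps => h1 h2; [left|right]; lra.
Qed.

Lemma mdist_midpoints_ge x y u u' v v' k : on_edge x u u' (1 / 2) ->
  on_edge y v v' (1 / 2) -> 0 < k ->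
  k <= d (V u) (V v) -> k <= d (V u) (V v') ->
  k <= d (V u') (V v) -> k <= d (V u') (V v') -> k + 1 <= d x y.
Proof.
move=> xm ym k0 h1 h2 h3 h4.
have hv := mdist_edge_vertex_ge xm h1 h3; have hv' := mdist_edge_vertex_ge xm h2 h4.
have [->|->|[s xs ->]] := mdist_edge x ym; [case: hv; lra | case: hv'; lra |].
have := mdist_left xs; have := mdist_right xs; rewrite !(metric_sym _ x).
by case: hv; case: hv'; lra.
Qed.

Lemma mdist_vertex_midpoint_ge w y v v' k : on_edge y v v' (1 / 2) ->
  k <= d (V w) (V v) -> k <= d (V w) (V v') -> k + 1 / 2 <= d (V w) y.
Proof. by move=> ym h1 h2; have [->|->] := mdist_vertex_edge w ym; lra. Qed.

End Polylines.

(** * Lower bounds *)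

Lemma mdist_edge_vertex_min (R : realType) (G : graph) (p : realization R G) (u v w : G) s k l r :
  on_edge p u v s -> k <= mdist (vertex_point R u) (vertex_point R w) ->
  l <= mdist (vertex_point R v) (vertex_point R w) ->
  r <= k + s -> r <= l + (1 - s) -> r <= mdist p (vertex_point R w).
Proof. by move=> ps h1 h2; have := mdist_edge_vertex_ge ps h1 h2; lra. Qed.

Lemma midpoint_ex (R : realType) (G : graph) (u v : G) : adj u v ->
  exists2 x : realization R G, on_edge x u v (1 / 2) & on_edge x v u (1 / 2).
Proof.
move=> uv; have [|||x xm] := @on_edge_ex R G u v (1 / 2); rewrite ?divr_ge0//; first lra.
exists x => //; rewrite (_ : 1 / 2 = 1 - 1 / 2); first exact: on_edge_sym.
lra.
Qed.

Section LexProductTriangles.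
Variables (R : realType) (G1 G2 : graph).
Local Notation G := (lexprod G1 G2).
Local Notation V := (@vertex_point R G).
Local Notation d := (@mdist R (realization R G)).

(** The two ways round the 4-cycle, between midpoints of opposite edges, form a bigon of length 2;
    [p] is the middle of one of them. *)
Lemma lexprod_delta_ge1 (a b : G1) (i j : G2) : adj a b -> adj i j ->
  (1%:E <= delta (realization R G))%E.
Proof.
move=> ab ij; have /eqP nij := adj_neq ij; have /eqP nab := adj_neq ab.
pose a1 : G := (a, i); pose a2 : G := (a, j); pose b1 : G := (b, i); pose b2 : G := (b, j).
have a12 : adj a1 a2 by right.
have b12 : adj b1 b2 by right.
have a1b1 : adj a1 b1 by left.
have a2b2 : adj a2 b2 by left.
have ne u v : u <> v -> 1 <= d (V u) (V v) by exact: mdist_vertex_ge1.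
have ha u v : u.1 = a -> v.1 = b -> 1 <= d (V u) (V v).
  by move=> ua vb; apply: ne => uv; move/eqP: nab; apply; rewrite -ua -vb uv.
have hi u v : u.2 = i -> v.2 = j -> 1 <= d (V u) (V v).
  by move=> ui vj; apply: ne => uv; move/eqP: nij; apply; rewrite -ui -vj uv.
have [x xm xm'] := midpoint_ex R a12.
have [y ym ym'] := midpoint_ex R b12.
have [p pm _] := midpoint_ex R a1b1.
have xy : 1 + 1 <= d x y by apply: mdist_midpoints_ge xm ym _ _ _ _ _; rewrite ?ltr01//; exact: ha.
have /polyline_geodesic hA :=
  polyline_half xm (polyline_edge a1b1 (polyline_end ym)).
have /polyline_geodesic hB :=
  polyline_half xm' (polyline_edge a2b2 (polyline_end ym')).
have pa1 : 1 / 2 <= d p (V a1).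
  by apply: (mdist_edge_vertex_min pm (mdist_ge0 (V a1) (V a1)) (mdist_ge0 (V b1) (V a1))); lra.
have pb1 : 1 / 2 <= d p (V b1).
  by apply: (mdist_edge_vertex_min pm (mdist_ge0 (V a1) (V b1)) (mdist_ge0 (V b1) (V b1))); lra.
have pa2 : 3 / 2 <= d p (V a2).
  by apply: (mdist_edge_vertex_min pm (hi a1 a2 erefl erefl) (hi b1 a2 erefl erefl)); lra.
have pb2 : 3 / 2 <= d p (V b2).
  by apply: (mdist_edge_vertex_min pm (hi a1 b2 erefl erefl) (hi b1 b2 erefl erefl)); lra.
apply: (@delta_ge_bigon _ _ x y _ _ p 1 (hA _) (hB _)); try lra.
  by right; left; exists (1 / 2) => //; lra.
by move=> q [h|[h|h]]; apply: (edge_segment_far h); lra.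
Qed.

(** The midpoint of the edge and the vertex over [w] are at distance 5/2, because within the layer
    of [a] the vertex [w] is far from both ends. The point [p] is the middle of a geodesic joining
    them, hence the parameter 3/4. *)
Lemma lexprod_delta_ge54_far_edge (a b : G1) (w i j : G2) : adj a b -> adj i j ->
  ~ eq_or_adj w i -> ~ eq_or_adj w j -> ((5 / 4)%:E <= delta (realization R G))%E.
Proof.
move=> ab ij nwi nwj; have /eqP nij := adj_neq ij; have /eqP nab := adj_neq ab.
pose a1 : G := (a, i); pose a2 : G := (a, j); pose aw : G := (a, w).
pose b1 : G := (b, i); pose b2 : G := (b, j).
have a12 : adj a1 a2 by right.
have a1b1 : adj a1 b1 by left.
have a2b2 : adj a2 b2 by left.
have b1w : adj b1 aw by left; exact: adj_sym.
have b2w : adj b2 aw by left; exact: adj_sym.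
have ne u v : u <> v -> 1 <= d (V u) (V v) by exact: mdist_vertex_ge1.
have ha u v : u.1 = b -> v.1 = a -> 1 <= d (V u) (V v).
  by move=> ua vb; apply: ne => uv; move/eqP: nab; apply; rewrite -ua -vb uv.
have hi u v : u.2 = i -> v.2 = j -> 1 <= d (V u) (V v).
  by move=> ui vj; apply: ne => uv; move/eqP: nij; apply; rewrite -ui -vj uv.
have far k : ~ eq_or_adj w k -> 2 <= d (V aw) (V (a, k)).
  move=> nwk; apply: mdist_vertex_ge2 => [[wk]|].
    by apply: nwk; left.
  by case=> [/adj_irrefl//|[_ wk]]; apply: nwk; right.
have hw1 := far _ nwi; have hw2 := far _ nwj.
have [x xm xm'] := midpoint_ex R a12.
have [p pm] : exists p : realization R G, on_edge p a1 b1 (3 / 4)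
  by apply: on_edge_ex => //; lra.
have xy := mdist_vertex_midpoint_ge xm hw1 hw2; rewrite metric_sym in xy.
have /polyline_geodesic hA :=
  polyline_half xm (polyline_edge a1b1 (polyline_edge b1w (polyline_vertex R aw))).
have /polyline_geodesic hB :=
  polyline_half xm' (polyline_edge a2b2 (polyline_edge b2w (polyline_vertex R aw))).
rewrite metric_sym in hw1.
have pa1 : 3 / 4 <= d p (V a1).
  by apply: (mdist_edge_vertex_min pm (mdist_ge0 (V a1) (V a1)) (ha b1 a1 erefl erefl)); lra.
have pw : 5 / 4 <= d p (V aw).
  by apply: (mdist_edge_vertex_min pm hw1 (ha b1 aw erefl erefl)); lra.
have pa2 : 5 / 4 <= d p (V a2).
  by apply: (mdist_edge_vertex_min pm (hi a1 a2 erefl erefl) (hi b1 a2 erefl erefl)); lra.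
have pb2 : 5 / 4 <= d p (V b2).
  by apply: (mdist_edge_vertex_min pm (hi a1 b2 erefl erefl) (hi b1 b2 erefl erefl)); lra.
apply: (@delta_ge_bigon _ _ x (V aw) _ _ p (5 / 4) (hA _) (hB _)); try lra.
  by right; left; exists (3 / 4) => //; lra.
by move=> q [h|[h|[h|->]]]; [apply: (edge_segment_far h) ..|]; lra.
Qed.

(** The midpoints over [a] and [c] are at distance 3, but the middle vertex [b1] of the first
    geodesic is adjacent to the vertices of the second. Moving 1/4 away from [b1] balances $1+1/4$
    against the distance $3/2-1/4$ to [y]. *)
Lemma lexprod_delta_ge54_path (a b c : G1) (i j : G2) : adj a b -> adj b c ->
  ~ eq_or_adj a c -> adj i j -> ((5 / 4)%:E <= delta (realization R G))%E.
Proof.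
move=> ab bc nac ij; have /eqP nij := adj_neq ij; have /eqP nab := adj_neq ab.
pose a1 : G := (a, i); pose a2 : G := (a, j); pose b1 : G := (b, i); pose b2 : G := (b, j).
pose c1 : G := (c, i); pose c2 : G := (c, j).
have a12 : adj a1 a2 by right.
have c12 : adj c1 c2 by right.
have a1b1 : adj a1 b1 by left.
have a2b2 : adj a2 b2 by left.
have b1c1 : adj b1 c1 by left.
have b2c2 : adj b2 c2 by left.
have ne u v : u <> v -> 1 <= d (V u) (V v) by exact: mdist_vertex_ge1.
have hi u v : u.2 = i -> v.2 = j -> 1 <= d (V u) (V v).
  by move=> ui vj; apply: ne => uv; move/eqP: nij; apply; rewrite -ui -vj uv.
have hab u v : u.1 = b -> v.1 = a -> 1 <= d (V u) (V v).
  by move=> ua vb; apply: ne => uv; move/eqP: nab; apply; rewrite -ua -vb uv.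
have hac k l : 2 <= d (V (a, k)) (V (c, l)).
  apply: mdist_vertex_ge2 => [[kl _]|]; first by apply: nac; left.
  by case=> [kl|[kl _]]; apply: nac; [right|left].
have [x xm xm'] := midpoint_ex R a12.
have [y ym ym'] := midpoint_ex R c12.
have [p pm] : exists p : realization R G, on_edge p b1 c1 (1 / 4)
  by apply: on_edge_ex => //; lra.
have xy : 2 + 1 <= d x y by apply: mdist_midpoints_ge xm ym _ _ _ _ _ => //; exact: hac.
have /polyline_geodesic hA :=
  polyline_half xm (polyline_edge a1b1 (polyline_edge b1c1 (polyline_end ym))).
have /polyline_geodesic hB :=
  polyline_half xm' (polyline_edge a2b2 (polyline_edge b2c2 (polyline_end ym'))).
have ca1 := hac i i; have ca2 := hac j i; rewrite metric_sym in ca1; rewrite metric_sym in ca2.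
have pa1 : 5 / 4 <= d p (V a1).
  by apply: (mdist_edge_vertex_min pm (hab b1 a1 erefl erefl) ca1); lra.
have pa2 : 5 / 4 <= d p (V a2).
  by apply: (mdist_edge_vertex_min pm (hab b1 a2 erefl erefl) ca2); lra.
have pb2 : 5 / 4 <= d p (V b2).
  by apply: (mdist_edge_vertex_min pm (hi b1 b2 erefl erefl) (hi c1 b2 erefl erefl)); lra.
have pc2 : 5 / 4 <= d p (V c2).
  by apply: (mdist_edge_vertex_min pm (hi b1 c2 erefl erefl) (hi c1 c2 erefl erefl)); lra.
have bc1 : 1 <= d (V b1) (V c1) by rewrite (mdist_adj R b1c1).
have pc1 : 3 / 4 <= d p (V c1).
  by apply: (mdist_edge_vertex_min pm bc1 (mdist_ge0 (V c1) (V c1))); lra.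
apply: (@delta_ge_bigon _ _ x y _ _ p (5 / 4) (hA _) (hB _)); try lra.
  by right; right; left; exists (1 / 4) => //; lra.
by move=> q [h|[h|[h|h]]]; apply: (edge_segment_far h); lra.
Qed.

Lemma vdist_fst_le (u v : G) : (vdist u.1 v.1 <= vdist u v)%N.
Proof.
elim: (vdist_walk u v) => [a|a b c n ab _ IH]; first by rewrite vdistxx.
case: (lex_adj_cases ab) => [[-> _]|ab1]; first exact: leqW.
apply: leq_trans (_ : (vdist b.1 c.1).+1 <= _)%N; last by [].
by apply: vdist_le; apply: walk_cons ab1 (vdist_walk _ _).
Qed.

(** Two geodesics of length 3 share their ends and use different copies of the two inner layers.
    From the midpoint of an inner edge every vertex other than its two ends is at distance at least
    3/2. *)
Lemma lexprod_delta_ge32_long (u v : G1) (i j : G2) : (2 < vdist u v)%N -> i != j ->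
  ((3 / 2)%:E <= delta (realization R G))%E.
Proof.
move=> + nij; case E : (vdist u v) => [|[|[|m]]] // _.
have {u E} [a] : exists a, vdist a v = 3.
  elim: m u E => [|m IH] u E; first by exists u.
  by have [w _ /IH] := vdistS E.
move=> av; have [b ab bv] := vdistS av; have [c bc cv] := vdistS bv.
have [e ce /vdist_eq0 ev] := vdistS cv; subst e.
pose a1 : G := (a, i); pose b1 : G := (b, i); pose b2 : G := (b, j).
pose c1 : G := (c, i); pose c2 : G := (c, j); pose v1 : G := (v, i).
have [h1 h2 h3] : [/\ @adj G a1 b1, @adj G b1 c1 & @adj G c1 v1] by split; left.
have [h1' h2' h3'] : [/\ @adj G a1 b2, @adj G b2 c2 & @adj G c2 v1] by split; left.
have [p pm _] := midpoint_ex R h2.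
have far w : w <> b1 -> w <> c1 -> 3 / 2 <= d p (V w).
  move=> wb wc; have := mdist_edge_vertex_ge pm
    (mdist_vertex_ge1 R (nesym wb)) (mdist_vertex_ge1 R (nesym wc)); lra.
have xy : 3 <= d (V a1) (V v1).
  by rewrite mdist_vertex ler_nat; apply: leq_trans (vdist_fst_le _ _); rewrite av.
have nb : a != b by exact/eqP/adj_neq.
have nc : a != c by apply/eqP => ac; move: av; rewrite ac cv.
have nvb : v != b by apply/eqP => vb; move: bv; rewrite vb vdistxx.
have nvc : v != c by rewrite eq_sym; exact/eqP/adj_neq.
have pa : 3 / 2 <= d p (V a1) by apply: far => -[/eqP]; rewrite ?(negbTE nb) ?(negbTE nc).
have pv : 3 / 2 <= d p (V v1) by apply: far => -[/eqP]; rewrite ?(negbTE nvb) ?(negbTE nvc).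
have pb : 3 / 2 <= d p (V b2) by apply: far => /(congr1 snd)/eqP; rewrite eq_sym (negbTE nij).
have pc : 3 / 2 <= d p (V c2) by apply: far => /(congr1 snd)/eqP; rewrite eq_sym (negbTE nij).
clear av bv cv nij.
have /polyline_geodesic hA :=
  polyline_edge h1 (polyline_edge h2 (polyline_edge h3 (polyline_vertex R v1))).
have /polyline_geodesic hB :=
  polyline_edge h1' (polyline_edge h2' (polyline_edge h3' (polyline_vertex R v1))).
apply: (@delta_ge_bigon _ _ (V a1) (V v1) _ _ p (3 / 2) (hA _) (hB _)); try lra.
  by right; left; exists (1 / 2) => //; lra.
by move=> q [h|[h|[h|->]]]; [apply: (edge_segment_far h) ..|]; lra.
Qed.

End LexProductTriangles.

(** * Triangles on chorded cycles *)

Lemma chorded_cycle_adj_mono n (S L : seq (nat * nat)) (i j : 'I_n) :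
  {subset S <= L} -> chorded_cycle_adj S i j -> chorded_cycle_adj L i j.
Proof.
move=> SL; rewrite /chorded_cycle_adj => /andP[-> /or4P[->|->|/SL->|/SL->]];
  by rewrite ?orbT.
Qed.

Lemma sval_injective (T : Type) (P : T -> Prop) : injective (@sval T P).
Proof.
by move=> [a Pa] [b Pb] /= ab; subst b; congr exist; exact: Prop_irrelevance.
Qed.

(** The induced graph is squeezed between the cycle and the cycle with all of [L], so the subset of
    chords actually present need not be named. *)
Definition cycle_with_chords (G : simple_graph) n (L : seq (nat * nat)) (v : 'I_n -> G) :=
  [/\ injective v, forall i j, chorded_cycle_adj [::] i j -> adj (v i) (v j) &
      forall i j, adj (v i) (v j) -> chorded_cycle_adj L i j].

Lemma in_FP (G : simple_graph) : in_F G <->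
  exists n L (v : 'I_n -> G), (n, L) \in F_patterns /\ cycle_with_chords L v.
Proof.
split=> [[n [L [S [W [nL SL [f [[g fK gK] fadj]]]]]]]|[n [L [v [nL [vinj h1 h2]]]]]].
  have gadj (i j : 'I_n) : adj (sval (g i)) (sval (g j)) <-> chorded_cycle_adj S i j.
    by have := fadj (g i) (g j); rewrite !gK.
  exists n, L, (fun i => sval (g i)); split=> //; split=> [i j|i j|i j].
  - by move/sval_injective/(can_inj gK).
  - by move=> h; apply/gadj; apply: chorded_cycle_adj_mono h.
  - by move/gadj; exact: chorded_cycle_adj_mono.
pose S := [seq c <- L | `[< exists i j : 'I_n, c = (i.+1, j.+1) /\ adj (v i) (v j) >]].
have SL : {subset S <= L} by move=> c; rewrite mem_filter => /andP[].
have SE i j : adj (v i) (v j) <-> chorded_cycle_adj S i j.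
  have inS (k l : 'I_n) : (k.+1, l.+1) \in S -> adj (v k) (v l).
    rewrite mem_filter => /andP[/asboolP[k' [l' [[/val_inj -> /val_inj ->] kl]]] _].
    exact: kl.
  split=> [ij|].
    have := h2 _ _ ij; rewrite /chorded_cycle_adj => /andP[-> /or4P[->|->|hij|hji]] //=;
      rewrite ?orbT//.
      suff -> : (i.+1, j.+1) \in S by rewrite !orbT.
      by rewrite mem_filter hij andbT; apply/asboolP; exists i, j.
    suff -> : (j.+1, i.+1) \in S by rewrite !orbT.
    by rewrite mem_filter hji andbT; apply/asboolP; exists j, i; split=> //; exact: adj_sym.
  rewrite /chorded_cycle_adj => /andP[ij /or4P[h|h|/inS//|/inS/adj_sym//]];
    by apply: h1; rewrite /chorded_cycle_adj ij h ?orbT.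
exists n, L, S, (range v); split=> //.
have fP (x : induced (range v)) : exists i, v i = sval x.
  by have [i _ vx] := svalP x; exists i.
pose g (i : chorded_cycle n S) : induced (range v) := exist _ (v i) (ex_intro2 _ _ i I erefl).
pose f (x : induced (range v)) : chorded_cycle n S := sval (cid (fP x)).
have fE x : v (f x) = sval x by rewrite /f; case: cid.
exists f; split; last by move=> x y; have := SE (f x) (f y); rewrite !fE.
exists g => [x|i]; last by apply: vinj; rewrite fE.
by apply: sval_injective; rewrite /= fE.
Qed.

Section PatternTriangle.
Variables (R : realType) (G : graph).
Local Notation V := (@vertex_point R G).
Local Notation d := (@mdist R (realization R G)).
Implicit Types (u v w : G) (x y z q : realization R G).

Lemma far_edge w u v s t q : 2 <= d (V w) (V u) -> 2 <= d (V w) (V v) ->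
  0 <= s -> t <= 1 -> edge_segment u v s t q -> 3 / 2 <= d (V w) q.
Proof. by move=> h1 h2 s0 t1 h; apply: (edge_segment_far h); lra. Qed.

Lemma far_half_edge w u v q : 2 <= d (V w) (V u) -> adj w v ->
  edge_segment u v 0 (1 / 2) q -> 3 / 2 <= d (V w) q.
Proof.
by move=> h1 /(mdist_adj R) h2 h; apply: (edge_segment_far h); rewrite ?h2; lra.
Qed.

Lemma pattern_side v1 v2 v3 v4 v5 x y :
  on_edge x v2 v1 (1 / 2) -> on_edge y v4 v5 (1 / 2) -> adj v2 v3 -> adj v3 v4 ->
  2 <= d (V v1) (V v4) -> 2 <= d (V v1) (V v5) ->
  2 <= d (V v2) (V v4) -> 2 <= d (V v2) (V v5) ->
  exists2 A, geodesic_segment x y A & A (V v3).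
Proof.
move=> xm ym h23 h34 h14 h15 h24 h25.
have xy : 2 + 1 <= d x y by apply: mdist_midpoints_ge xm ym _ _ _ _ _.
have /polyline_geodesic hA :=
  polyline_half xm (polyline_edge h23 (polyline_edge h34 (polyline_end ym))).
eexists; first by apply: hA; lra.
by right; left; exists 1; [lra | exact: on_edge_right].
Qed.

End PatternTriangle.

Section PatternLowerBound.
Variables (R : realType) (G : graph).
Local Notation V := (@vertex_point R G).
Local Notation d := (@mdist R (realization R G)).

Lemma cycle_with_chords_far n L (v : 'I_n -> G) i j : cycle_with_chords L v ->
  (i != j) && ~~ chorded_cycle_adj L i j -> 2 <= d (V (v i)) (V (v j)).
Proof.
move=> [vinj h1 h2] /andP[ij nij]; apply: mdist_vertex_ge2.
  by move/vinj => e; rewrite e eqxx in ij.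
by move/h2; exact/negP.
Qed.

Lemma cycle_with_chords_ge1 n L (v : 'I_n -> G) i j : cycle_with_chords L v ->
  i != j -> 1 <= d (V (v i)) (V (v j)).
Proof. by move=> [vinj _ _] ij; apply: mdist_vertex_ge1 => /vinj e; rewrite e eqxx in ij. Qed.

Lemma cycle_with_chords_edge n L (v : 'I_n -> G) i j : cycle_with_chords L v ->
  chorded_cycle_adj [::] i j -> adj (v i) (v j).
Proof. by case=> _ h _; exact: h. Qed.

Definition chordless n L (i j : 'I_n) := (i != j) && ~~ chorded_cycle_adj L i j.

(** Common to all patterns: the side of length 3 through $v_1,\dots,v_5$ between midpoints, with
    middle $v_3$, and the two half edges where the other sides start. The rest of those sides is
    handled by [pattern_far]. *)
Lemma pattern_base n L (v : 'I_n -> G) i1 i2 i3 i4 i5 : cycle_with_chords L v ->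
  [&& chorded_cycle_adj [::] i1 i2, chorded_cycle_adj [::] i2 i3,
      chorded_cycle_adj [::] i3 i4 & chorded_cycle_adj [::] i4 i5] ->
  [&& chordless L i1 i4, chordless L i1 i5, chordless L i2 i4, chordless L i2 i5,
      chordless L i3 i1 & chordless L i3 i5] ->
  exists x y : realization R G,
  [/\ on_edge x (v i1) (v i2) (1 / 2) /\ on_edge x (v i2) (v i1) (1 / 2),
      on_edge y (v i5) (v i4) (1 / 2) /\ on_edge y (v i4) (v i5) (1 / 2),
      exists2 A, geodesic_segment x y A & A (V (v i3)),
      forall q, edge_segment (v i1) (v i2) 0 (1 / 2) q -> 3 / 2 <= d (V (v i3)) q &
      forall q, edge_segment (v i5) (v i4) 0 (1 / 2) q -> 3 / 2 <= d (V (v i3)) q].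
Proof.
move=> hv /and4P[/(cycle_with_chords_edge hv) e12 /(cycle_with_chords_edge hv) e23
  /(cycle_with_chords_edge hv) e34 /(cycle_with_chords_edge hv) e45].
move=> /and5P[/(cycle_with_chords_far hv) f14 /(cycle_with_chords_far hv) f15
  /(cycle_with_chords_far hv) f24 /(cycle_with_chords_far hv) f25
  /andP[/(cycle_with_chords_far hv) f31 /(cycle_with_chords_far hv) f35]].
have [x xm xm'] := midpoint_ex R e12; have [y ym ym'] := midpoint_ex R e45.
exists x, y; split=> //; first exact: pattern_side xm' ym e23 e34 f14 f15 f24 f25.
  by move=> q; apply: far_half_edge f31 (adj_sym e23).
by move=> q; apply: far_half_edge f35 e34.
Qed.

Lemma pattern_far n L (v : 'I_n -> G) c i j s t q : cycle_with_chords L v ->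
  chordless L c i -> chordless L c j -> 0 <= s -> t <= 1 ->
  edge_segment (v i) (v j) s t q -> 3 / 2 <= d (V (v c)) q.
Proof.
by move=> hv /(cycle_with_chords_far hv) hi /(cycle_with_chords_far hv) hj; exact: far_edge.
Qed.

Lemma pattern_midpoints n L (v : 'I_n -> G) x y i i' j j' : cycle_with_chords L v ->
  on_edge x (v i) (v i') (1 / 2) -> on_edge y (v j) (v j') (1 / 2) ->
  [&& i != j, i != j', i' != j & i' != j'] -> 2 <= d x y.
Proof.
move=> hv xm ym /and4P[]; do 4 move=> /(@cycle_with_chords_ge1 _ _ _ _ _ hv) ?.
exact: (mdist_midpoints_ge xm ym).
Qed.

Lemma pattern_far_midpoints n L (v : 'I_n -> G) x y i i' j j' : cycle_with_chords L v ->
  on_edge x (v i) (v i') (1 / 2) -> on_edge y (v j) (v j') (1 / 2) ->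
  [&& chordless L i j, chordless L i j', chordless L i' j & chordless L i' j'] ->
  3 <= d x y.
Proof.
move=> hv xm ym /and4P[]; do 4 move=> /(cycle_with_chords_far hv) ?.
have h : 2 + 1 <= d x y by apply: (mdist_midpoints_ge xm ym).
lra.
Qed.

Local Notation edge hv i j := (cycle_with_chords_edge (i := i) (j := j) hv isT).

(** [@o k] stands for $v_{k+1}$. The other way round the cycle also has length 3, so a bigon
    suffices; in the longer cycles [z] is placed where the allowed chords do not shorten the sides
    ending there. *)
Lemma pattern6_delta_ge (v : 'I_6 -> G) :
  cycle_with_chords [:: (2, 6); (4, 6)]%N v ->
  ((3 / 2)%:E <= delta (realization R G))%E.
Proof.
pose o k (hk : (k < 6)%N) : 'I_6 := Ordinal hk.
move=> hv; have [|//|x [y [[xm _] [ym ym'] [A hA A3] hx hy]]] := pattern_base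
  (i1 := @o 0 isT) (i2 := @o 1 isT) (i3 := @o 2 isT) (i4 := @o 3 isT) (i5 := @o 4 isT) hv.
  by [].
have xy := pattern_far_midpoints hv xm ym isT.
have /polyline_geodesic hB :=
  polyline_half xm (polyline_edge (edge hv (@o 0 isT) (@o 5 isT))
    (polyline_edge (edge hv (@o 5 isT) (@o 4 isT)) (polyline_end ym))).
apply: (@delta_ge_bigon _ _ x y _ _ _ (3 / 2) hA (hB _) A3); first lra.
by move=> q [/hx//|[h|[h|/hy//]]]; apply: pattern_far hv _ _ _ _ h.
Qed.

(** [z] is the midpoint of $v_6v_7$. Both further sides have length 2, and midpoints of disjoint
    edges are never closer, whatever the chords. *)
Lemma pattern7_delta_ge (v : 'I_7 -> G) :
  cycle_with_chords [:: (2, 6); (2, 7); (4, 6); (4, 7)]%N v ->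
  ((3 / 2)%:E <= delta (realization R G))%E.
Proof.
pose o k (hk : (k < 7)%N) : 'I_7 := Ordinal hk.
move=> hv; have [//|//|x [y [[xm _] [ym _] [A hA A3] hx hy]]] := pattern_base
  (i1 := @o 0 isT) (i2 := @o 1 isT) (i3 := @o 2 isT) (i4 := @o 3 isT) (i5 := @o 4 isT) hv.
have [z zm zm'] := midpoint_ex R (edge hv (@o 5 isT) (@o 6 isT)).
have yz := pattern_midpoints hv ym zm isT.
have zx := pattern_midpoints hv zm' xm isT.
have /polyline_geodesic hB :=
  polyline_half ym (polyline_edge (edge hv (@o 4 isT) (@o 5 isT))
    (polyline_end zm)).
have /polyline_geodesic hC := polyline_half zm' (polyline_edge (edge hv (@o 6 isT) (@o 0 isT))
    (polyline_end xm)).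
apply: (@delta_ge _ _ x y z _ _ _ _ (3 / 2) (And3 hA (hB _) (hC _)) A3); try lra.
move=> q [[/hy//|[h|h]]|[h|[h|/hx//]]];
  try by apply: (pattern_far hv _ _ _ _ h) => //; lra.
Qed.

(** [z] is the vertex $v_7$, which has no chord; both further sides have length 5/2. *)
Lemma pattern8_delta_ge (v : 'I_8 -> G) :
  cycle_with_chords [:: (2, 6); (2, 8); (4, 6); (4, 8)]%N v ->
  ((3 / 2)%:E <= delta (realization R G))%E.
Proof.
pose o k (hk : (k < 8)%N) : 'I_8 := Ordinal hk.
move=> hv; have [//|//|x [y [[xm _] [ym _] [A hA A3] hx hy]]] := pattern_base
  (i1 := @o 0 isT) (i2 := @o 1 isT) (i3 := @o 2 isT) (i4 := @o 3 isT) (i5 := @o 4 isT) hv.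
have yz : 2 + 1 / 2 <= d (V (v (@o 6 isT))) y.
  by apply: (mdist_vertex_midpoint_ge ym); apply: (cycle_with_chords_far hv).
have zx : 2 + 1 / 2 <= d (V (v (@o 6 isT))) x.
  by apply: (mdist_vertex_midpoint_ge xm); apply: (cycle_with_chords_far hv).
rewrite (metric_sym _ y) in yz.
have /polyline_geodesic hB :=
  polyline_half ym (polyline_edge (edge hv (@o 4 isT) (@o 5 isT))
    (polyline_edge (edge hv (@o 5 isT) (@o 6 isT))
    (polyline_vertex R (v (@o 6 isT))))).
have /polyline_geodesic hC := polyline_edge (edge hv (@o 6 isT) (@o 7 isT))
    (polyline_edge (edge hv (@o 7 isT) (@o 0 isT))
    (polyline_end xm)).
apply: (@delta_ge _ _ x y (V (v (@o 6 isT))) _ _ _ _ (3 / 2) (And3 hA (hB _) (hC _)) A3); try lra.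
move=> q [[/hy//|[h|[h|->]]]|[h|[h|/hx//]]];
  try by apply: (pattern_far hv _ _ _ _ h) => //; lra.
have := cycle_with_chords_far (i := @o 2 isT) (j := @o 6 isT) hv isT; lra.
Qed.

(** [z] is the midpoint of $v_6v_7$. The side to [y] has length 2 and tolerates chords at $v_4$; the
    side to [x] has length 3, as $v_2$ has no chord to $v_6$ or $v_7$. *)
Lemma pattern8'_delta_ge (v : 'I_8 -> G) :
  cycle_with_chords [:: (2, 8); (4, 6); (4, 7); (4, 8)]%N v ->
  ((3 / 2)%:E <= delta (realization R G))%E.
Proof.
pose o k (hk : (k < 8)%N) : 'I_8 := Ordinal hk.
move=> hv; have [//|//|x [y [[xm _] [ym _] [A hA A3] hx hy]]] := pattern_base
  (i1 := @o 0 isT) (i2 := @o 1 isT) (i3 := @o 2 isT) (i4 := @o 3 isT) (i5 := @o 4 isT) hv.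
have [z zm zm'] := midpoint_ex R (edge hv (@o 5 isT) (@o 6 isT)).
have yz := pattern_midpoints hv ym zm isT.
have zx := pattern_far_midpoints hv zm' xm isT.
have /polyline_geodesic hB :=
  polyline_half ym (polyline_edge (edge hv (@o 4 isT) (@o 5 isT))
    (polyline_end zm)).
have /polyline_geodesic hC := polyline_half zm' (polyline_edge (edge hv (@o 6 isT) (@o 7 isT))
    (polyline_edge (edge hv (@o 7 isT) (@o 0 isT))
    (polyline_end xm))).
apply: (@delta_ge _ _ x y z _ _ _ _ (3 / 2) (And3 hA (hB _) (hC _)) A3); try lra.
move=> q [[/hy//|[h|h]]|[h|[h|[h|/hx//]]]];
  try by apply: (pattern_far hv _ _ _ _ h) => //; lra.
Qed.

(** [z] is the midpoint of $v_7v_8$, an edge whose ends have no chords; both further sides have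
    length 3. *)
Lemma pattern9_delta_ge (v : 'I_9 -> G) :
  cycle_with_chords [:: (2, 6); (2, 9); (4, 6); (4, 9)]%N v ->
  ((3 / 2)%:E <= delta (realization R G))%E.
Proof.
pose o k (hk : (k < 9)%N) : 'I_9 := Ordinal hk.
move=> hv; have [//|//|x [y [[xm _] [ym _] [A hA A3] hx hy]]] := pattern_base
  (i1 := @o 0 isT) (i2 := @o 1 isT) (i3 := @o 2 isT) (i4 := @o 3 isT) (i5 := @o 4 isT) hv.
have [z zm zm'] := midpoint_ex R (edge hv (@o 6 isT) (@o 7 isT)).
have yz := pattern_far_midpoints hv ym zm isT.
have zx := pattern_far_midpoints hv zm' xm isT.
have /polyline_geodesic hB :=
  polyline_half ym (polyline_edge (edge hv (@o 4 isT) (@o 5 isT))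
    (polyline_edge (edge hv (@o 5 isT) (@o 6 isT))
    (polyline_end zm))).
have /polyline_geodesic hC := polyline_half zm' (polyline_edge (edge hv (@o 7 isT) (@o 8 isT))
    (polyline_edge (edge hv (@o 8 isT) (@o 0 isT))
    (polyline_end xm))).
apply: (@delta_ge _ _ x y z _ _ _ _ (3 / 2) (And3 hA (hB _) (hC _)) A3); try lra.
move=> q [[/hy//|[h|[h|h]]]|[h|[h|[h|/hx//]]]];
  try by apply: (pattern_far hv _ _ _ _ h) => //; lra.
Qed.

Lemma pattern_delta_ge n L (v : 'I_n -> G) : (n, L) \in F_patterns ->
  cycle_with_chords L v -> ((3 / 2)%:E <= delta (realization R G))%E.
Proof.
rewrite !inE => /or4P[/eqP[? ?]|/eqP[? ?]|/eqP[? ?]|/orP[]/eqP[? ?]]; subst n L.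
- exact: pattern6_delta_ge.
- exact: pattern7_delta_ge.
- exact: pattern8_delta_ge.
- exact: pattern8'_delta_ge.
- exact: pattern9_delta_ge.
Qed.

End PatternLowerBound.

(** The pattern triangles use only adjacency and non-adjacency on the cycle, and these are unchanged
    when the cycle is copied into one layer. *)
Lemma lexprod_delta_ge_in_F (R : realType) (G1 G2 : graph) : in_F G2 ->
  ((3 / 2)%:E <= delta (realization R (lexprod G1 G2)))%E.
Proof.
move=> /in_FP[n [L [v [nL [vinj h1 h2]]]]]; have [o _] := graph_nonempty G1.
apply: (@pattern_delta_ge R (lexprod G1 G2) n L (fun i => (o, v i)) nL); split.
- by move=> i j [] /vinj.
- by move=> i j /h1; right.
- by move=> i j; case=> [/adj_irrefl//|[_ /h2]].
Qed.

(** * The upper bound 5/4 *)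

Section PatternDetection.
Variable H : simple_graph.
Implicit Types (u v w t : H).
Local Notation far u v := (~ eq_or_adj u v).

Lemma cycle_with_chords_intro n L (v : 'I_n -> H) :
  (forall i j : 'I_n, (i < j)%N ->
     if chorded_cycle_adj [::] i j then adj (v i) (v j)
     else if chorded_cycle_adj L i j then v i <> v j else far (v i) (v j)) ->
  cycle_with_chords L v.
Proof.
move=> h; have irr (i : 'I_n) (S : seq (nat * nat)) : chorded_cycle_adj S i i = false.
  by apply/negP/chorded_cycle_adj_irrefl.
have sub (i j : 'I_n) : chorded_cycle_adj [::] i j -> chorded_cycle_adj L i j.
  exact: chorded_cycle_adj_mono.
have key (i j : 'I_n) : (i < j)%N -> [/\ v i <> v j,
    chorded_cycle_adj [::] i j -> adj (v i) (v j) &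
    adj (v i) (v j) -> chorded_cycle_adj L i j].
  move=> /h; have := sub i j; case: (chorded_cycle_adj [::] i j) => [/(_ isT) -> vij|_].
    by split=> // e; move: vij; rewrite e => /adj_irrefl.
  case: (chorded_cycle_adj L i j) => [//|nvij]; split=> // e; case: nvij; [by left|by right].
split=> [i j vij|i j|i j].
- by apply/val_inj; case: (ltngtP i j) => // /key[ne _ _]; case: ne.
- case: (ltngtP i j) => [/key[]//|/key[_ hji _] hij|/val_inj ->]; last by rewrite irr.
  by apply/adj_sym/hji/chorded_cycle_adj_sym.
- case: (ltngtP i j) => [/key[]//|/key[_ _ hji] /adj_sym /hji|/val_inj ->].
    exact: chorded_cycle_adj_sym.
  by move/adj_irrefl.
Qed.

(** These are $v_1,\dots,v_5$; below, [t6], [t7], ... continue the cycle from [b'] back to [a']. *)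
Variables a' a m b b' : H.
Hypotheses (a'a : adj a' a) (am : adj a m) (mb : adj m b) (bb' : adj b b').
Hypotheses (a'm : far a' m) (a'b : far a' b) (a'b' : far a' b').
Hypotheses (ab : far a b) (ab' : far a b') (mb' : far m b').

Let far_neq u v w : far u v -> adj u w -> w <> v.
Proof. by move=> uv uw wv; apply: uv; right; rewrite -wv. Qed.

Let far_sym u v : far u v -> far v u.
Proof. by move=> uv /eq_or_adj_sym. Qed.

Lemma pattern6_in_F t : adj b' t -> adj t a' -> far m t -> in_F H.
Proof.
move=> b't ta' mt; apply/in_FP.
exists 6, [:: (2, 6); (4, 6)]%N, (fun i : 'I_6 => nth m [:: a'; a; m; b; b'; t] i).
split=> //; apply: cycle_with_chords_intro.
have h1 := far_neq mt (adj_sym am); have h2 := far_neq mt mb.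
by move=> [[|[|[|[|[|[|//]]]]]] ?] [[|[|[|[|[|[|//]]]]]] ?] //= _; do ?[exact: adj_sym].
Qed.

(** A chord that shortens the path from [b'] to [a'] gives the shorter pattern; without one, only
    the chords permitted at [a] and [b] are left. The longer patterns are found in the same way. *)
Lemma pattern7_in_F t6 t7 : adj b' t6 -> adj t6 t7 -> adj t7 a' ->
  far m t6 -> far m t7 -> in_F H.
Proof.
move=> b6 h67 h7a m6 m7.
have [[e|?]|b7] := pselect (eq_or_adj b' t7); last first.
- have [[e|?]|a6] := pselect (eq_or_adj t6 a'); last first.
  + apply/in_FP; exists 7, [:: (2, 6); (2, 7); (4, 6); (4, 7)]%N.
    exists (fun i : 'I_7 => nth m [:: a'; a; m; b; b'; t6; t7] i).
    split=> //; apply: cycle_with_chords_intro.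
    have h1 := far_neq m6 (adj_sym am); have h2 := far_neq m6 mb.
    have h3 := far_neq m7 (adj_sym am); have h4 := far_neq m7 mb.
    by move=> [[|[|[|[|[|[|[|//]]]]]]] ?] [[|[|[|[|[|[|[|//]]]]]]] ?] //= _;
      do ?[exact: adj_sym | exact: far_sym].
  + exact: (@pattern6_in_F t6).
  + by case: a'b'; right; rewrite -e; exact: adj_sym.
- exact: (@pattern6_in_F t7).
- by case: a'b'; right; rewrite e; exact: adj_sym.
Qed.

Let pattern8_induced L t6 t7 t8 : adj b' t6 -> adj t6 t7 -> adj t7 t8 -> adj t8 a' ->
  far m t6 -> far m t7 -> far m t8 ->
  far b' t7 -> far b' t8 -> far t6 t8 -> far t6 a' -> far t7 a' ->
  [\/ L = [:: (2, 6); (2, 8); (4, 6); (4, 8)]%N /\ far a t7 /\ far b t7 |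
      L = [:: (2, 8); (4, 6); (4, 7); (4, 8)]%N /\ far a t6 /\ far a t7] ->
  (8, L) \in F_patterns /\
  cycle_with_chords L (fun i : 'I_8 => nth m [:: a'; a; m; b; b'; t6; t7; t8] i).
Proof.
move=> b6 h67 h78 h8a m6 m7 m8 b7 b8 f68 f6a f7a hL.
have h1 := far_neq m6 (adj_sym am); have h2 := far_neq m6 mb.
have h3 := far_neq m7 (adj_sym am); have h4 := far_neq m7 mb.
have h5 := far_neq m8 (adj_sym am); have h6 := far_neq m8 mb.
case: hL => [[-> [a7 bt7]]|[-> [a6 a7]]]; split=> //; apply: cycle_with_chords_intro.
  by move=> [[|[|[|[|[|[|[|[|//]]]]]]]] ?] [[|[|[|[|[|[|[|[|//]]]]]]]] ?] //= _;
  do ?[exact: adj_sym | exact: far_sym].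
by move=> [[|[|[|[|[|[|[|[|//]]]]]]]] ?] [[|[|[|[|[|[|[|[|//]]]]]]]] ?] //= _;
  do ?[exact: adj_sym | exact: far_sym].
Qed.

Lemma pattern8_in_F t6 t7 t8 : adj b' t6 -> adj t6 t7 -> adj t7 t8 -> adj t8 a' ->
  far m t6 -> far m t7 -> far m t8 ->
  far a t7 /\ far b t7 \/ far a t6 /\ far a t7 -> in_F H.
Proof.
move=> b6 h67 h78 h8a m6 m7 m8 hab.
have [[e|?]|b7] := pselect (eq_or_adj b' t7).
- by subst t7; apply: (@pattern6_in_F t8).
- exact: (@pattern7_in_F t7 t8).
have [[e|?]|b8] := pselect (eq_or_adj b' t8).
- by case: a'b'; right; rewrite e; exact: adj_sym.
- exact: (@pattern6_in_F t8).
have [[e|?]|f68] := pselect (eq_or_adj t6 t8).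
- by subst t8; apply: (@pattern6_in_F t6).
- exact: (@pattern7_in_F t6 t8).
have [[e|?]|f6a] := pselect (eq_or_adj t6 a').
- by case: a'b'; right; rewrite -e; exact: adj_sym.
- exact: (@pattern6_in_F t6).
have [[e|?]|f7a] := pselect (eq_or_adj t7 a').
- by subst t7; apply: (@pattern6_in_F t6).
- exact: (@pattern7_in_F t6 t7).
have ind L := @pattern8_induced L _ _ _ b6 h67 h78 h8a m6 m7 m8 b7 b8 f68 f6a f7a.
by apply/in_FP; case: hab => hab; do 3 eexists; apply: ind; [left|right].
Qed.

(** Whenever a shortcut leaves three vertices, the middle one is [t7] or [t8], which is far from
    both [a] and [b]; this is what [pattern8_in_F] asks for. *)
Lemma pattern9_in_F t6 t7 t8 t9 : adj b' t6 -> adj t6 t7 -> adj t7 t8 -> adj t8 t9 ->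
  adj t9 a' -> far m t6 -> far m t7 -> far m t8 -> far m t9 ->
  far a t7 -> far a t8 -> far b t7 -> far b t8 -> in_F H.
Proof.
move=> b6 h67 h78 h89 h9a m6 m7 m8 m9 a7 a8 bt7 bt8.
have [[e|?]|f7] := pselect (eq_or_adj b' t7).
- by subst t7; apply: (@pattern7_in_F t8 t9).
- by apply: (@pattern8_in_F t7 t8 t9) => //; left.
have [[e|?]|f8] := pselect (eq_or_adj b' t8).
- by subst t8; apply: (@pattern6_in_F t9).
- exact: (@pattern7_in_F t8 t9).
have [[e|?]|f9] := pselect (eq_or_adj b' t9).
- by case: a'b'; right; rewrite e; exact: adj_sym.
- exact: (@pattern6_in_F t9).
have [[e|?]|f68] := pselect (eq_or_adj t6 t8).
- by subst t8; apply: (@pattern7_in_F t6 t9).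
- by apply: (@pattern8_in_F t6 t8 t9) => //; left.
have [[e|?]|f69] := pselect (eq_or_adj t6 t9).
- by subst t9; apply: (@pattern6_in_F t6).
- exact: (@pattern7_in_F t6 t9).
have [[e|?]|f6a] := pselect (eq_or_adj t6 a').
- by case: a'b'; right; rewrite -e; exact: adj_sym.
- exact: (@pattern6_in_F t6).
have [[e|?]|f79] := pselect (eq_or_adj t7 t9).
- by subst t9; apply: (@pattern7_in_F t6 t7).
- by apply: (@pattern8_in_F t6 t7 t9) => //; left.
have [[e|?]|f7a] := pselect (eq_or_adj t7 a').
- by subst t7; apply: (@pattern6_in_F t6).
- exact: (@pattern7_in_F t6 t7).
have [[e|?]|f8a] := pselect (eq_or_adj t8 a').
- by subst t8; apply: (@pattern7_in_F t6 t7).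
- by apply: (@pattern8_in_F t6 t7 t8) => //; left.
apply/in_FP; exists 9, [:: (2, 6); (2, 9); (4, 6); (4, 9)]%N.
exists (fun i : 'I_9 => nth m [:: a'; a; m; b; b'; t6; t7; t8; t9] i).
split=> //; apply: cycle_with_chords_intro.
have h1 := far_neq m6 (adj_sym am); have h2 := far_neq m6 mb.
have h3 := far_neq m7 (adj_sym am); have h4 := far_neq m7 mb.
have h5 := far_neq m8 (adj_sym am); have h6 := far_neq m8 mb.
have h7 := far_neq m9 (adj_sym am); have h8 := far_neq m9 mb.
by move=> [[|[|[|[|[|[|[|[|[|//]]]]]]]]] ?] [[|[|[|[|[|[|[|[|[|//]]]]]]]]] ?] //= _;
  do ?[exact: adj_sym | exact: far_sym].
Qed.

End PatternDetection.

Lemma geodesic_mdist (R : realType) (X : metricType R) (x y p q : X) (A : set X) :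
  geodesic_segment x y A -> A p -> A q -> mdist p q = `|mdist x p - mdist x q|.
Proof.
move=> hA Ap Aq; have [g [_ _ gi _ gE]] := geodesic_param hA.
have hp := geodesic_between hA Ap; have hq := geodesic_between hA Aq.
rewrite -{1}(gE _ Ap) -{1}(gE _ Aq) gi ?mdist_ge0// -?hp -?hq ?lerDl ?mdist_ge0//.
by rewrite hp -hq lerDl mdist_ge0.
Qed.

(** [ws] and [us] are the vertices met from [a'] and from [b'] on the way to [z]; their ends
    coincide or span the edge containing [z]. Together they give at most four further vertices. *)
Lemma chain_in_F (H : simple_graph) (a' a m b b' : H) (ws us : seq H) :
  adj a' a -> adj a m -> adj m b -> adj b b' ->
  ~ eq_or_adj a' m -> ~ eq_or_adj a' b -> ~ eq_or_adj a' b' ->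
  ~ eq_or_adj a b -> ~ eq_or_adj a b' -> ~ eq_or_adj m b' ->
  path (fun u v => `[< adj u v >]) a' ws -> path (fun u v => `[< adj u v >]) b' us ->
  (size ws <= 2)%N -> (size us <= 2)%N ->
  {in ws, forall v, ~ eq_or_adj m v} -> {in us, forall v, ~ eq_or_adj m v} ->
  (size ws = 2 -> ~ eq_or_adj a (last a' ws)) ->
  (size us = 2 -> ~ eq_or_adj b (last b' us)) ->
  last a' ws = last b' us \/
  [/\ adj (last b' us) (last a' ws), size ws = 2 -> ~ eq_or_adj a (last b' us) &
      size us = 2 -> ~ eq_or_adj b (last a' ws)] ->
  in_F H.
Proof.
move=> a'a am mb bb' a'm a'b a'b' ab ab' mb'.
have far_sym (u v : H) : ~ eq_or_adj u v -> ~ eq_or_adj v u by move=> uv /eq_or_adj_sym.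
have P6 := @pattern6_in_F H a' a m b b' a'a am mb bb' a'm a'b a'b' ab ab' mb'.
have P7 := @pattern7_in_F H a' a m b b' a'a am mb bb' a'm a'b a'b' ab ab' mb'.
have P8 := @pattern8_in_F H a' a m b b' a'a am mb bb' a'm a'b a'b' ab ab' mb'.
have P9 := @pattern9_in_F H a' a m b b' a'a am mb bb' a'm a'b a'b' ab ab' mb'.
(* The pattern $C_8^{(2)}$ is not symmetric; its mirror image serves the case of one vertex in [ws]
   and two in [us]. *)
have P8' := @pattern8_in_F H b' b m a a' (adj_sym bb') (adj_sym mb) (adj_sym am)
  (adj_sym a'a) (far_sym _ _ mb') (far_sym _ _ ab') (far_sym _ _ a'b') (far_sym _ _ ab)
  (far_sym _ _ a'b) (far_sym _ _ a'm).
have nadj : adj b' a' -> False by move=> h; apply: a'b'; right; exact: adj_sym.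
have asb (u v : H) : `[< adj u v >] -> adj u v by move/asboolP.
case: ws => [|w1 [|w2 [|//]]]; case: us => [|u1 [|u2 [|//]]] //=.
all: rewrite ?andbT => hw hu _ _ mw mu aw bu hend.
all: try have /asb ? := hw; try have /asb ? := hu.
all: try have /andP[/asb ? /asb ?] := hw; try have /andP[/asb ? /asb ?] := hu.
all: try have mw1 := mw w1 (mem_head _ _); try have mu1 := mu u1 (mem_head _ _).
all: try have mw2 := mw w2 (mem_last w1 [:: w2]); try have mu2 := mu u2 (mem_last u1 [:: u2]).
all: try have {}aw := aw erefl; try have {}bu := bu erefl.
all: case: hend => [e|[h aw' bu']].
all: try have {}aw' := aw' erefl; try have {}bu' := bu' erefl.
- by case: a'b'; left.
- by case: (nadj h).
- by subst u1; case: nadj.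
- by apply: (P6 u1) => //; exact: adj_sym.
- by subst u2; apply: (P6 u1).
- by apply: (P7 u1 u2) => //; exact: adj_sym.
- by subst w1; case: nadj; exact: adj_sym.
- by apply: (P6 w1) => //; exact: adj_sym.
- by subst w1; apply: (P6 u1) => //; exact: adj_sym.
- by apply: (P7 u1 w1) => //; exact: adj_sym.
- by subst w1; apply: (P7 u1 u2) => //; exact: adj_sym.
- by apply: (P8' w1 u2 u1) => //; [exact: adj_sym..|right].
- by subst w2; apply: (P6 w1) => //; exact: adj_sym.
- by apply: (P7 w2 w1) => //; exact: adj_sym.
- by subst w2; apply: (P7 u1 w1) => //; exact: adj_sym.
- by apply: (P8 u1 w2 w1) => //; [exact: adj_sym..|right].
- by subst w2; apply: (P8 u1 u2 w1) => //; [exact: adj_sym..|left].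
- by apply: (P9 u1 u2 w2 w1) => //; exact: adj_sym.
Qed.

Section LongSide.
Variables (R : realType) (G : graph).
Local Notation V := (@vertex_point R G).
Local Notation d := (@mdist R (realization R G)).
Implicit Types (u v w : G) (x y z p q : realization R G) (A B C : set (realization R G)).

Hypothesis vertex_diam : forall u v, d (V u) (V v) <= 2.

Lemma mdist_vertex_gt1 u v : 1 < d (V u) (V v) -> 2 <= d (V u) (V v).
Proof.
move=> h; rewrite leNgt; apply/negP => /mdist_vertex_lt2/(@mdist_vertex_le1 R).
by rewrite leNgt h.
Qed.

Lemma mdist_on_edges_le x y u u' v v' r s : on_edge x u u' r -> on_edge y v v' s ->
  d x y <= r + d (V u) (V v) + s.
Proof.
move=> xr ys; have := mdist_le_left (V u) ys; have := mdist_left xr.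
by have := metric_triangle x (V u) y; rewrite (metric_sym x (V u)); lra.
Qed.

(** The four routes through the ends of the edges of [x] and [y] have average length at most 3. *)
Lemma mdist_le3 x y u v : adj u v -> d x y <= 3.
Proof.
move=> uv; have [a [a' [r xr]]] := on_some_edge x uv.
have [b [b' [s ys]]] := on_some_edge y uv.
have xr' := on_edge_sym xr; have ys' := on_edge_sym ys.
have h1 := vertex_diam a b; have h2 := vertex_diam a b'.
have h3 := vertex_diam a' b; have h4 := vertex_diam a' b'.
have := mdist_on_edges_le xr ys; have := mdist_on_edges_le xr' ys.
have := mdist_on_edges_le xr ys'; have := mdist_on_edges_le xr' ys'; lra.
Qed.

Lemma near_edge q w c u v : adj u v -> d (V w) q = c -> c < 1 ->
  exists w', on_edge q w w' c.
Proof.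
move=> uv dq c1; have [a [b [t qt]]] := on_some_edge q uv.
have t0 := on_edge_ge0 qt; have t1 := on_edge_le1 qt.
have key a' : d (V w) (V a') < 1 -> w = a'.
  by move=> h; apply: contrapT => /(@mdist_vertex_ge1 R); rewrite leNgt h.
have [h|h] := mdist_vertex_edge w qt.
  have wa : w = a by apply: key; lra.
  by exists b; move: h; rewrite wa mdistxx add0r -wa dq => ->; rewrite wa.
have wb : w = b by apply: key; lra.
exists a; move: h; rewrite wb mdistxx add0r -wb dq => ->; rewrite wb.
exact: on_edge_sym.
Qed.

(** Since [u] is not on it, the geodesic leaves its first edge through [u']. Its length is at most 3
    and [1 - r] is positive, so at most two vertices follow before the remainder [c]. *)
Lemma geodesic_trace x z D u u' r : geodesic_segment x z D -> on_edge x u u' r ->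
  0 < r < 1 -> ~ D (V u) ->
  (exists t, on_edge z u u' t) \/
  exists ws c e, [/\ path (fun a b => `[< adj a b >]) u' ws /\ (size ws <= 2)%N,
    forall v, v \in u' :: ws -> D (V v), on_edge z (last u' ws) e c, c < 1 &
    d x z = 1 - r + (size ws)%:R + c].
Proof.
move=> hD xr r01 nu; have [h|[//]|[Du' xu']] := geodesic_exit hD xr r01; first by left.
right; have [uu' _ _] := xr.
have finish w k : D (V w) -> d x (V w) = 1 - r + k -> d x z < 1 - r + k + 1 ->
    exists c e, [/\ on_edge z w e c, c < 1 & d x z = 1 - r + k + c].
  move=> Dw xw hz; have hb := geodesic_between hD Dw.
  have [|e ze] := near_edge uu' (erefl (d (V w) z)); first by lra.
  by exists (d (V w) z), e; split=> //; lra.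
have L3 : d x z <= 3 by exact: mdist_le3 uu'.
have [h1|h1] := ltP (d x z) (1 - r + 0 + 1).
  have [|c [e [zc c1 dE]]] := finish u' 0 Du' _ h1; first by rewrite xu' addr0.
  exists [::], c, e; split=> //= v; rewrite inE => /eqP->; exact: Du'.
have [|w1 [Dw1 xw1 uw1]] := geodesic_next hD Du'; first by lra.
have [h2|h2] := ltP (d x z) (1 - r + 1 + 1).
  have [|c [e [zc c1 dE]]] := finish w1 1 Dw1 _ h2; first by rewrite xw1 xu'.
  exists [:: w1], c, e; split=> //=; first by rewrite andbT; split=> //; exact/asboolP.
  by move=> v; rewrite !inE => /orP[]/eqP->.
have [|w2 [Dw2 xw2 w12]] := geodesic_next hD Dw1; first by lra.
have [||c [e [zc c1 dE]]] := finish w2 2 Dw2; [lra|lra|].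
exists [:: w1; w2], c, e; split=> //=.
  by rewrite andbT; split=> //; apply/andP; split; exact/asboolP.
by move=> v; rewrite !inE => /or3P[]/eqP->.
Qed.

(** Comparing the length of the side, which exceeds 5/2, with the four routes through the ends of
    the edges of [x] and [y] puts each pair of ends at distance 2. The side then has length
    [2 + r + s], and the other routes give [r] and [s] at most 1/2. *)
Lemma long_side_middle x y A p : geodesic_segment x y A -> A p ->
  5 / 4 < d x p -> 5 / 4 < d p y ->
  exists u' u m w w' r s,
  [/\ [/\ on_edge x u u' r, on_edge y w w' s, 0 < r <= 1 / 2 & 0 < s <= 1 / 2],
      adj u m /\ adj m w, d p (V m) < 1 / 4,
      2 <= d (V u) (V w) /\ 2 <= d (V u) (V w') &
      2 <= d (V u') (V w) /\ 2 <= d (V u') (V w')].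
Proof.
move=> hA Ap xp py; have hp := geodesic_between hA Ap.
have [e0 [f0 ef]] : exists u v : G, adj u v by apply: (@adj_of_mdist_gt0 R G x p); lra.
have [a [a' [r0 xr]]] := on_some_edge x ef.
have [b [b' [s0 ys]]] := on_some_edge y ef.
have xr' := on_edge_sym xr; have ys' := on_edge_sym ys.
have h1 := vertex_diam a b; have h2 := vertex_diam a b'.
have h3 := vertex_diam a' b; have h4 := vertex_diam a' b'.
have i1 := mdist_on_edges_le xr ys; have i2 := mdist_on_edges_le xr' ys.
have i3 := mdist_on_edges_le xr ys'; have i4 := mdist_on_edges_le xr' ys'.
have r01 := on_edge_ge0 xr; have r11 := on_edge_le1 xr.
have s01 := on_edge_ge0 ys; have s11 := on_edge_le1 ys.
have rI : 0 < r0 < 1 by lra.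
have sI : 0 < s0 < 1 by lra.
have L52 : 5 / 2 < d x y by lra.
(* These also bound the sums for the opposite ends below 3/2; whichever ends the geodesic leaves
   through, their distance exceeds 1 and is therefore 2. *)
have rs1 : 1 / 2 < r0 + s0 by lra.
have rs2 : 1 / 2 < r0 + (1 - s0) by lra.
have rs3 : 1 / 2 < (1 - r0) + s0 by lra.
have rs4 : 1 / 2 < (1 - r0) + (1 - s0) by lra.
have same u v t t' : on_edge x u v t -> on_edge y u v t' -> 1 < d x y -> False.
  move=> xt yt; rewrite (mdist_same_edge xt yt) ltNge => /negP; apply; rewrite ler_norml.
  by have := on_edge_ge0 xt; have := on_edge_le1 xt; have := on_edge_ge0 yt;
    have := on_edge_le1 yt; lra.
have [u [u' [r [xu Au du]]]] : exists u u' r, [/\ on_edge x u u' r, A (V u) & d x (V u) = r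
    /\ (r = r0 \/ r = 1 - r0)].
  have [[t yt]|[Aa da]|[Aa' da']] := geodesic_exit hA xr rI.
  - by case: (same _ _ _ _ xr yt); lra.
  - by exists a, a', r0; split=> //; split=> //; left.
  - by exists a', a, (1 - r0); split=> //; split=> //; right.
have [w [w' [s [yw Aw dw]]]] : exists w w' s, [/\ on_edge y w w' s, A (V w) & d y (V w) = s
    /\ (s = s0 \/ s = 1 - s0)].
  have [[t xt]|[Aa da]|[Aa' da']] := geodesic_exit (geodesic_sym hA) ys sI.
  - by case: (same _ _ _ _ xt ys); lra.
  - by exists b, b', s0; split=> //; split=> //; left.
  - by exists b', b, (1 - s0); split=> //; split=> //; right.
move: du dw => [du hr] [dw hs].
have {r01 r11 rI hr} rI : 0 < r < 1 by clear -rI hr; case: hr => ->; lra.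
have {s01 s11 sI hs} sI : 0 < s < 1 by clear -sI hs; case: hs => ->; lra.
clear rs1 rs2 rs3 rs4 i1 i2 i3 i4 h1 h2 h3 h4 xr xr' ys ys' same.
have xu' := on_edge_sym xu; have yw' := on_edge_sym yw.
have j1 := vertex_diam u w; have j2 := vertex_diam u w'.
have j3 := vertex_diam u' w; have j4 := vertex_diam u' w'.
have i1 := mdist_on_edges_le xu yw; have i2 := mdist_on_edges_le xu yw'.
have i3 := mdist_on_edges_le xu' yw; have i4 := mdist_on_edges_le xu' yw'.
have bw := geodesic_between hA Aw; rewrite (metric_sym (V w) y) dw in bw.
have uw : d (V u) (V w) = d x y - r - s.
  by rewrite (geodesic_mdist hA Au Aw) du ler0_norm; lra.
have uw2 : 2 <= d (V u) (V w) by apply: mdist_vertex_gt1; lra.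
have uw2E : d (V u) (V w) = 2 by lra.
have L : d x y = 2 + r + s by lra.
have u'w2 : 2 <= d (V u') (V w) by apply: mdist_vertex_gt1; lra.
have uw'2 : 2 <= d (V u) (V w') by apply: mdist_vertex_gt1; lra.
have u'w'2 : 2 <= d (V u') (V w') by apply: mdist_vertex_gt1; lra.
have [|m [Am xm um]] := geodesic_next hA Au; first by lra.
have mw : adj m w.
  apply: (@adj_of_mdist1 R); rewrite (geodesic_mdist hA Am Aw) xm du ler0_norm; lra.
exists u', u, m, w, w', r, s; split=> //; first by split=> //; lra.
rewrite (geodesic_mdist hA Ap Am) xm du ltr_norml; lra.
Qed.

End LongSide.

Section UpperBoundOutsideF.
Variables (R : realType) (G1 G2 : graph).
Local Notation G := (lexprod G1 G2).
Local Notation V := (@vertex_point R G).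
Local Notation d := (@mdist R (realization R G)).
Implicit Types (u v w : G) (x y z p q : realization R G).

Lemma same_layer_adj v w : v.1 = w.1 -> adj v w -> adj v.2 w.2.
Proof. by move=> vw /lex_adj_cases[[]//|]; rewrite vw => /adj_irrefl. Qed.

Lemma same_layer_far v w : v.1 = w.1 -> ~ eq_or_adj v w -> ~ eq_or_adj v.2 w.2.
Proof.
move=> vw nvw [e|h]; apply: nvw; last by right; right.
by left; case: v w vw e => [v1 v2] [w1 w2] /= -> ->.
Qed.

(** A step out of the layer of [m] lands in an adjacent layer, all of whose vertices are neighbours
    of [m]. *)
Lemma same_layer_path (m v : G) (ws : seq G) : v.1 = m.1 ->
  path (fun a b : G => `[< adj a b >]) v ws -> {in ws, forall w, ~ eq_or_adj m w} ->
  [/\ {in ws, forall w, w.1 = m.1},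
      path (fun a b : G2 => `[< adj a b >]) v.2 (map snd ws) &
      {in map snd ws, forall j, ~ eq_or_adj m.2 j}].
Proof.
elim: ws v => [|w ws IH] v vm; first by split.
move=> /andP[/asboolP vw hp] far.
have wm : w.1 = m.1.
  apply: contrapT => wm; apply: (far w (mem_head _ _)); right; left; rewrite -vm.
  by case: (lex_adj_cases vw) => [[vw1 _]|//]; case: wm; rewrite -vw1.
have [|h1 h2 h3] := IH w wm hp; first by move=> a aws; apply: far; exact: (@mem_behead _ (w :: ws)).
split; first by move=> a /predU1P[->|/h1].
  by apply/andP; split=> //; apply/asboolP; apply: same_layer_adj vw; rewrite vm wm.
move=> j /predU1P[->|/h3//]; apply: (@same_layer_far m w); first by rewrite wm.
exact: (far w (mem_head _ _)).
Qed.

Lemma walk_lift (a b : G1) n : walk a b n -> (0 < n)%N -> forall i j,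
  walk ((a, i) : G) (b, j) n.
Proof.
elim=> // {n}u v w [|n] uv vw IH _ i j.
  by inversion vw; subst; apply: walk1; left.
by apply: walk_cons (IH isT i j); left.
Qed.

Hypothesis edge1 : exists a b : G1, adj a b.
Hypothesis diam1 : forall a b : G1, (vdist a b <= 2)%N.

Lemma lexprod_vertex_diam v w : d (V v) (V w) <= 2.
Proof.
have [vw|vw] := eqVneq v.1 w.1; first exact: mdist_layer_le2.
rewrite mdist_vertex ler_nat; apply: leq_trans (diam1 v.1 w.1); apply: vdist_le.
have := walk_lift (vdist_walk v.1 w.1) _ v.2 w.2; rewrite -!surjective_pairing; apply.
by rewrite lt0n; apply: contraNneq vw => /vdist_eq0->.
Qed.

Hypothesis treeG1 : tree G1.

(** Otherwise the four vertices project to a path of length 3 without backtracking: a step inside a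
    layer, or a backtrack, would create one of the excluded adjacencies. In a tree the ends of such
    a path are at distance 3. *)
Lemma middle_same_layer u' u m w : adj u' u -> adj u m -> adj m w ->
  ~ eq_or_adj u' m -> ~ eq_or_adj u' w -> ~ eq_or_adj u w -> u.1 = m.1.
Proof.
move=> u'u um mw nu'm nu'w nuw; apply: contrapT => um1.
have {um}um : adj u.1 m.1 by case: (lex_adj_cases um) => [[]|].
have {u'u}u'u : adj u'.1 u.1.
  by case: (lex_adj_cases u'u) => [[e _]|//]; case: nu'm; right; left; rewrite e.
have {mw}mw : adj m.1 w.1.
  by case: (lex_adj_cases mw) => [[e _]|//]; case: nuw; right; left; rewrite -e.
have wu : w.1 <> u.1 by move=> e; apply: nu'w; right; left; rewrite e.
have u'm : u'.1 <> m.1 by move=> e; apply: nu'w; right; left; rewrite e.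
have wm : w.1 <> m.1 by exact/nesym/adj_neq.
have na : ~ adj u'.1 w.1 by move=> e; apply: nu'w; right; left.
have av := avoids_step (avoids_refl m.1 u.1) (adj_sym u'u) u'm.
have fin : avoids m.1 u.1 w.1 -> False.
  by move=> /(tree_neighbor_unique treeG1 (adj_sym um) mw) e; exact: wu.
have := diam1 u'.1 w.1; case E : (vdist u'.1 w.1) => [|[|[|k]]] // _.
- by apply: fin; rewrite -(vdist_eq0 E).
- by have [b u'b /vdist_eq0 bw] := vdistS E; subst b.
- have [b u'b E1] := vdistS E; have [c bc /vdist_eq0 cw] := vdistS E1; subst c.
  have [bm|bm] := pselect (b = m.1).
    by apply: (tree_no_triangle treeG1 u'u um); rewrite -bm.
  by apply: fin; apply: avoids_step (avoids_step av u'b bm) bc wm.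
Qed.

(* [x] lies on the edge [u u'], which a geodesic from [x] to [z] leaves through
   [u'], following then [ws]; otherwise the route through [u] is shorter. *)
Lemma trace_end_far x z u u' (ws : seq G) r c e : on_edge x u u' r -> r <= 1 / 2 ->
  d x z = 1 - r + (size ws)%:R + c -> on_edge z (last u' ws) e c ->
  size ws = 2 -> ~ eq_or_adj u (last u' ws).
Proof.
move=> xr r2 dxz zc sz /(@mdist_vertex_le1 R) h; rewrite sz in dxz.
have := mdist_le_left x zc; have := metric_triangle x (V u) (V (last u' ws)).
by have := mdist_left xr; rewrite (metric_sym (V u) x); lra.
Qed.

Lemma trace_end_far' x z u u' (ws : seq G) r c v e : on_edge x u u' r -> r <= 1 / 2 ->
  d x z = 1 - r + (size ws)%:R + c -> on_edge z v e (1 - c) -> 0 < c ->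
  size ws = 2 -> ~ eq_or_adj u v.
Proof.
move=> xr r2 dxz zc c0 sz /(@mdist_vertex_le1 R) h; rewrite sz in dxz.
by have := mdist_on_edges_le xr zc; lra.
Qed.

Lemma lexprod_delta_le54 : ~ in_F G2 -> (delta (realization R G) <= (5 / 4)%:E)%E.
Proof.
move=> nF; apply: delta_le => [|x y z A B C p [hA hB hC] Ap]; first by lra.
apply: contrapT => /dist_set_far[e0 e00 far]; apply: nF.
have px : 5 / 4 < d x p.
  have := far x (or_intror (geodesic_right hC)); rewrite (metric_sym p x); lra.
have py : 5 / 4 < d p y by have := far y (or_introl (geodesic_left hB)); lra.
have [u' [u [m [w [w' [r [s [[xr ys r01 s01] [um mw] pm [uw uw'] [u'w u'w']]]]]]]]] :=
  long_side_middle lexprod_vertex_diam hA Ap px py.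
(* A neighbour of [m] is within $1/4+1$ of [p], too close for the other sides. *)
have farm v : (B `|` C) (V v) -> ~ eq_or_adj m v.
  move=> /far pv /(@mdist_vertex_le1 R); have := metric_triangle p (V m) (V v); lra.
have d2 a b : 2 <= d (V a) (V b) -> ~ eq_or_adj a b.
  by move=> h /(@mdist_vertex_le1 R); lra.
have nQu : ~ (B `|` C) (V u) by move/farm; apply; right; exact: adj_sym.
have nQw : ~ (B `|` C) (V w) by move/farm; apply; right.
have [uu' _ _] := xr; have [ww' _ _] := ys.
have zQ : (B `|` C) z by left; exact: geodesic_right hB.
have [ws [us [[pws sws] [pus sus] fws fus [aw bu hend]]]] : exists ws us : seq G,
  [/\ path (fun a b => `[< adj a b >]) u' ws /\ (size ws <= 2)%N,
      path (fun a b => `[< adj a b >]) w' us /\ (size us <= 2)%N,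
      {in u' :: ws, forall v, ~ eq_or_adj m v},
      {in w' :: us, forall v, ~ eq_or_adj m v} &
      [/\ size ws = 2 -> ~ eq_or_adj u (last u' ws),
          size us = 2 -> ~ eq_or_adj w (last w' us) &
          last u' ws = last w' us \/
            [/\ adj (last w' us) (last u' ws),
                size ws = 2 -> ~ eq_or_adj u (last w' us) &
                size us = 2 -> ~ eq_or_adj w (last u' ws)]]].
  have nCu : ~ C (V u) by move=> h; apply: nQu; right.
  have nBw : ~ B (V w) by move=> h; apply: nQw; left.
  have rI : 0 < r < 1 by lra.
  have sI : 0 < s < 1 by lra.
  have r2 : r <= 1 / 2 by lra.
  have s2 : s <= 1 / 2 by lra.
  (* When [z] is still on the first edge of one side, the trace of the other side must end at the
     end of that edge that the sides do not avoid. *)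
  have meet (a a' v e : G) t c : ~ (B `|` C) (V a) -> (B `|` C) (V v) ->
      on_edge z a a' t -> on_edge z v e c -> c < 1 -> v = a'.
    move=> na Qv zt zc c1; have [[av _ _]|[_ -> _]//|[[zE _]|[zE _]]] := on_edge_cases zt zc.
    - by case: na; rewrite av.
    - by case: na; rewrite -zE.
    - by rewrite zE in zc; have [[->]|[_ cE]] := on_edge_vertex zc; rewrite // cE ltxx in c1.
  have [[t zt]|[ws [c [e [[pws sws] Dws zc c1 dxz]]]]] :=
    geodesic_trace lexprod_vertex_diam (geodesic_sym hC) xr rI nCu;
  have [[t' zt']|[us [c' [e' [[pus sus] Dus zc' c1' dyz]]]]] :=
    geodesic_trace lexprod_vertex_diam hB ys sI nBw.
  (* If [z] were on both end edges, the distances from [u] to [w] and from [u'] to [w'] would add up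
     to at most 2, while each is at least 2. *)
  - have := mdist_left zt; have := mdist_left zt'.
    have := mdist_right zt; have := mdist_right zt'.
    have := metric_triangle (V u) z (V w); have := metric_triangle (V u') z (V w').
    by rewrite !(metric_sym z); lra.
  - have lE : last w' us = u' by apply: meet zt zc' c1' => //; left; apply: Dus; exact: mem_last.
    exists [::], us; split=> //.
    + move=> v /predU1P[->|//]; rewrite -lE; apply: farm; left; apply: Dus.
      exact: mem_last.
    + by move=> v /Dus Bv; apply: farm; left.
    + split=> //; [exact: trace_end_far ys s2 dyz zc' | by left].
  - have lE : last u' ws = w' by apply: meet zt' zc c1 => //; right; apply: Dws; exact: mem_last.
    exists ws, [::]; split=> //.
    + by move=> v /Dws Cv; apply: farm; right.
    + move=> v /predU1P[->|//]; rewrite -lE; apply: farm; right; apply: Dws.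
      exact: mem_last.
    + split=> //; [exact: trace_end_far xr r2 dxz zc | by left].
  - exists ws, us; split=> //.
    + by move=> v /Dws Cv; apply: farm; right.
    + by move=> v /Dus Bv; apply: farm; left.
    split; [exact: trace_end_far xr r2 dxz zc | exact: trace_end_far ys s2 dyz zc' |].
    (* Both traces end at an end of an edge containing [z]: at the same end, or at opposite ends,
       which are then adjacent. *)
    have [[-> _ _]|[_ ae cc]|[[zE _]|[_ cE]]] := on_edge_cases zc zc'; first by left.
    + right; rewrite -ae in zc' *; have [ee _ _] := zc; split; first 1 last.
      * apply: (trace_end_far' xr r2 dxz (v := e) (e := last u' ws)); last by lra.
        exact: on_edge_sym.
      * apply: (trace_end_far' ys s2 dyz (v := last u' ws) (e := e)); last by lra.
        by have -> : 1 - c' = c by lra.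
      * exact: adj_sym.
    + left; rewrite zE in zc'; have [[->//]|[_ cE]] := on_edge_vertex zc'.
      by rewrite cE ltxx in c1'.
    + by rewrite cE ltxx in c1.
have nu'm : ~ eq_or_adj u' m.
  by move/eq_or_adj_sym; apply: fws; exact: mem_head.
have nmw' : ~ eq_or_adj m w' by apply: fus; exact: mem_head.
have u'u : adj u' u := adj_sym uu'.
have um1 := middle_same_layer u'u um mw nu'm (d2 _ _ u'w) (d2 _ _ uw).
have wm1 : w.1 = m.1.
  have far_sym a b : ~ eq_or_adj a b -> ~ eq_or_adj b a by move=> h /eq_or_adj_sym.
  by apply: (middle_same_layer (adj_sym ww') (adj_sym mw) (adj_sym um)); apply: far_sym;
    [exact: nmw' | exact: d2 uw' | exact: d2 uw].
have u'm1 : u'.1 = m.1.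
  apply: contrapT => h; apply: nu'm; right; left; rewrite -um1.
  by case: (lex_adj_cases u'u) => [[e _]|//]; case: h; rewrite e.
have w'm1 : w'.1 = m.1.
  apply: contrapT => h; apply: nmw'; right; left; rewrite -wm1.
  by case: (lex_adj_cases ww') => [[e _]|//]; case: h; rewrite -e.
have {}fws : {in ws, forall v, ~ eq_or_adj m v}.
  by move=> v vw; apply: fws; exact: (@mem_behead _ (u' :: ws)).
have {}fus : {in us, forall v, ~ eq_or_adj m v}.
  by move=> v vw; apply: fus; exact: (@mem_behead _ (w' :: us)).
have [lws pws2 fws2] := same_layer_path u'm1 pws fws.
have [lus pus2 fus2] := same_layer_path w'm1 pus fus.
have llw : (last u' ws).1 = m.1.
  by have := mem_last u' ws => /predU1P[->|/lws].
have llu : (last w' us).1 = m.1.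
  by have := mem_last w' us => /predU1P[->|/lus].
apply: (@chain_in_F G2 u'.2 u.2 m.2 w.2 w'.2 (map snd ws) (map snd us));
  rewrite ?size_map ?last_map //.
- by apply: same_layer_adj u'u; rewrite u'm1.
- by apply: same_layer_adj um; rewrite um1.
- by apply: same_layer_adj mw; rewrite wm1.
- by apply: same_layer_adj ww'; rewrite wm1.
- by apply: same_layer_far nu'm; rewrite u'm1.
- by apply: same_layer_far (d2 _ _ u'w); rewrite u'm1 wm1.
- by apply: same_layer_far (d2 _ _ u'w'); rewrite u'm1 w'm1.
- by apply: same_layer_far (d2 _ _ uw); rewrite um1 wm1.
- by apply: same_layer_far (d2 _ _ uw'); rewrite um1 w'm1.
- by apply: same_layer_far nmw'; rewrite w'm1.
- by move=> /aw; apply: same_layer_far; rewrite llw.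
- by move=> /bu; apply: same_layer_far; rewrite llu.
- case: hend => [->|[h1 h2 h3]]; [by left | right; split].
  + by apply: same_layer_adj h1; rewrite llw.
  + by move=> /h2; apply: same_layer_far; rewrite llu.
  + by move=> /h3; apply: same_layer_far; rewrite llw.
Qed.

End UpperBoundOutsideF.

(** * The theorem *)

Section DiameterFacts.
Variables (R : realType) (G : graph).
Local Notation V := (@vertex_point R G).
Local Notation d := (@mdist R (realization R G)).

Lemma diam_leP r : (diam (realization R G) <= r%:E)%E <-> forall x y, d x y <= r.
Proof.
split=> [h x y|h].
  rewrite -lee_fin; apply: le_trans h; apply: ereal_sup_ubound; by exists x, y.
by apply: ge_ereal_sup => e [x [y ->]]; rewrite lee_fin.
Qed.

Lemma diam_ge1_edge : (1%:E <= diam (realization R G))%E -> exists u v : G, adj u v.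
Proof.
move=> h; apply: contrapT => ne.
have : (diam (realization R G) <= 0%:E)%E.
  apply/diam_leP => x y; rewrite leNgt; apply/negP => /adj_of_mdist_gt0; exact: ne.
by move=> /(le_trans h); rewrite lee_fin ler10.
Qed.

Lemma diam_le1_adj : (diam (realization R G) <= 1%:E)%E -> forall u v : G, eq_or_adj u v.
Proof.
move=> /diam_leP h u v; apply: (@mdist_vertex_lt2 R); have := h (V u) (V v); lra.
Qed.

Lemma diam_le2_vdist : (diam (realization R G) <= 2%:E)%E -> forall u v : G, (vdist u v <= 2)%N.
Proof. by move=> /diam_leP h u v; rewrite -(ler_nat R) -mdist_vertex. Qed.

Hypothesis treeG : tree G.

(** A vertex far from both ends of an edge reaches them through neighbours [n] and [n']. These
    agree, since otherwise a cycle closes up, and then form a triangle with the edge. *)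
Lemma tree_near_all_edges : (forall u v : G, (vdist u v <= 2)%N) -> near_all_edges G.
Proof.
move=> h w u v uv; apply: contrapT => nwuv.
have mid t : ~ eq_or_adj w t -> exists2 n, adj w n & adj n t.
  move=> nwt; have := h w t; case E : (vdist w t) => [|[|[|k]]] // _.
  - by case: nwt; left; exact: vdist_eq0.
  - by case: nwt; right; have [b wb /vdist_eq0 <-] := vdistS E.
  - have [b wb E1] := vdistS E; have [c bc /vdist_eq0 ct] := vdistS E1; subst c.
    by exists b.
have nu : ~ eq_or_adj w u by move=> e; apply: nwuv; left.
have nv : ~ eq_or_adj w v by move=> e; apply: nwuv; right.
have [n wn nu1] := mid _ nu; have [n' wn' nv1] := mid _ nv.
have uw : u <> w by move=> e; apply: nu; left.
have vw : v <> w by move=> e; apply: nv; left.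
have nn' : n = n'.
  apply: (tree_neighbor_unique treeG wn wn').
  apply: avoids_step (adj_sym nv1) (nesym (adj_neq wn')).
  exact: avoids_step (avoids_step (avoids_refl w n) nu1 uw) uv vw.
by apply: (tree_no_triangle treeG nu1 uv); rewrite nn'.
Qed.

(** A complete tree with an edge has no third vertex, as that would make a triangle; so both points
    lie on the same edge. *)
Lemma tree_complete_mdist : (forall u v : G, eq_or_adj u v) ->
  (exists u v : G, adj u v) -> forall x y, d x y <= 1.
Proof.
move=> h [u [v uv]] x y.
have [a [a' [r xr]]] := on_some_edge x uv; have [b [b' [s ys]]] := on_some_edge y uv.
have [aa' _ _] := xr; have [bb' _ _] := ys.
have ends t : t = a \/ t = a'.
  case: (h a t) => [->|at_]; first by left.
  case: (h a' t) => [->|a't]; first by right.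
  by case: (tree_no_triangle treeG aa' a't at_).
have main s' : on_edge y a a' s' -> d x y <= 1.
  move=> ys'; rewrite (mdist_same_edge xr ys') ler_norml.
  have := on_edge_ge0 xr; have := on_edge_le1 xr.
  by have := on_edge_ge0 ys'; have := on_edge_le1 ys'; lra.
have nbb := adj_neq bb'.
case: (ends b) (ends b') => ? [] ?; subst b b'; try by case: nbb.
  exact: main ys.
exact: main (on_edge_sym ys).
Qed.

End DiameterFacts.

Lemma path_of_not_complete (G : graph) (u v : G) : ~ eq_or_adj u v ->
  exists a b c : G, [/\ adj a b, adj b c & ~ eq_or_adj a c].
Proof.
move=> nuv; case E : (vdist u v) => [|[|k]].
- by case: nuv; left; exact: vdist_eq0.
- by case: nuv; right; have [b wb /vdist_eq0 <-] := vdistS E.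
have [b ub E1] := vdistS E; have [c bc E2] := vdistS E1; exists u, b, c; split=> //.
case=> [uc|uc]; first by move: E; rewrite uc E2 => /eqP; rewrite ltn_eqF.
have := vdist_le (walk_cons uc (vdist_walk c v)).
by rewrite E E2 ltnn.
Qed.

Theorem theorem3p24 (R : realType) (G1 G2 : graph) (hG1 : tree G1) :
  let dG := delta (realization R (lexprod G1 G2)) in
  let diam1 := diam (realization R G1) in
  let diam2 := diam (realization R G2) in
  [/\ isomorphic G1 E1 -> dG = delta (realization R G2),
      isomorphic G2 E1 -> dG = 0%:E,
      diam1 = 1%:E -> (1%:E <= diam2 <= 2%:E)%E -> dG = 1%:E,
      diam1 = 1%:E -> (2%:E < diam2)%E -> ~ in_F G2 -> dG = (5 / 4)%:E
    & [/\ diam1 = 2%:E -> (1%:E <= diam2)%E -> ~ in_F G2 -> dG = (5 / 4)%:E,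
          (1%:E <= diam1 <= 2%:E)%E -> in_F G2 -> dG = (3 / 2)%:E
        & (3%:E <= diam1)%E -> (1%:E <= diam2)%E -> dG = (3 / 2)%:E]].
Proof.
move=> dG diam1 diam2.
have le12 : (1%:E <= 2%:E :> \bar R)%E by rewrite lee_fin ler1n.
split; [| | | |split].
- by move=> /(lexprod_trivial_left G2) /(isomorphic_delta R).
- by move=> /(lexprod_trivial_right G1) /(isomorphic_delta R) h; rewrite /dG h tree_delta.
- move=> d1 /andP[d21 d22].
  have [a [b ab]] : exists a b : G1, adj a b.
    by apply: (@diam_ge1_edge R); rewrite -/diam1 d1.
  have [i [j ij]] := diam_ge1_edge d21.
  apply/le_anti; rewrite (lexprod_delta_ge1 R ab ij) andbT.
  have N : near_all_edges (lexprod G1 G2).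
    apply: near_all_edges_lexprod; first by apply: (@diam_le1_adj R); rewrite -/diam1 d1.
    by apply: (@mdist_near_all_edges R); apply/diam_leP.
  have e : @adj (lexprod G1 G2) (a, i) (b, i) by left.
  by apply: delta_le_half_diam => x y; have := near_all_edges_mdist x y e N; lra.
- move=> d1 d2 nF.
  have [a [b ab]] : exists a b : G1, adj a b.
    by apply: (@diam_ge1_edge R); rewrite -/diam1 d1.
  have [i [j ij]] := diam_ge1_edge (le_trans le12 (ltW d2)).
  apply/le_anti/andP; split.
    apply: lexprod_delta_le54 nF => //; first by exists a, b.
    by apply: (@diam_le2_vdist R); rewrite -/diam1 d1.
  (* Without the bound no vertex of [G2] is far from both ends of an edge, and then [G2] has
     diameter at most 2. *)
  apply: contrapT => nd; move: d2; rewrite ltNge => /negP; apply; apply/diam_leP => x y.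
  apply: near_all_edges_mdist ij _ => w k l kl; apply: contrapT => nw; apply: nd.
  apply: (@lexprod_delta_ge54_far_edge R G1 G2 a b w k l ab kl) => h; apply: nw.
    by left.
  by right.
- move=> d1 d2 nF.
  have e1 : exists a b : G1, adj a b by apply: (@diam_ge1_edge R); rewrite -/diam1 d1.
  have [i [j ij]] := diam_ge1_edge d2.
  apply/le_anti/andP; split.
    by apply: lexprod_delta_le54 nF => //; apply: (@diam_le2_vdist R); rewrite -/diam1 d1.
  have [u [v uv]] : exists u v : G1, ~ eq_or_adj u v.
    apply: contrapT => nuv; suff : (diam1 <= 1%:E)%E by rewrite d1 lee_fin lern1.
    apply/diam_leP; apply: tree_complete_mdist => // u v.
    by apply: contrapT => h; apply: nuv; exists u, v.
  have [a [b [c [ab bc ac]]]] := path_of_not_complete uv.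
  exact: lexprod_delta_ge54_path ab bc ac ij.
- move=> /andP[d1 _] hF; have e1 := diam_ge1_edge d1.
  by apply/le_anti/andP; split; [exact: lexprod_tree_delta_le | exact: lexprod_delta_ge_in_F].
- move=> d1 d2; have [i [j ij]] := diam_ge1_edge d2.
  have e1 : exists a b : G1, adj a b.
    by apply: (@diam_ge1_edge R); apply: le_trans d1; rewrite lee_fin ler1n.
  apply/le_anti/andP; split; first exact: lexprod_tree_delta_le.
  (* The diameter counts all points, so it need not be realized by vertices; but a tree whose
     vertices are within 2 of each other has all its points within 2. *)
  have [u [v uv]] : exists u v : G1, (2 < vdist u v)%N.
    apply: contrapT => nuv; suff : (diam1 <= 2%:E)%E.
      by move/(le_trans d1); rewrite lee_fin ler_nat.
    apply/diam_leP => x y; have [a [b ab]] := e1.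
    apply: near_all_edges_mdist ab _; apply: tree_near_all_edges => // u v.
    by rewrite leqNgt; apply/negP => h; apply: nuv; exists u, v.
  have nij : i != j by apply/eqP; exact: adj_neq.
  exact: lexprod_delta_ge32_long uv nij.
Qed.
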